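(* The following two assertions are equivalent. (a) There is a sub-exponential sequence of positive real numbers $(c_n)_{n\ge 1}$ such that for every $n\ge 1$ and every symplectically self-polar convex body $X\subset\mathbb R^{2n}$ (that is, $X^\omega = X$) one has $$\operatorname{vol} X \ge c_n\frac{2^n}{n!}.$$ (b) Mahler's conjecture for centrally symmetric bodies holds in all dimensions: for every $n\ge 1$ and every centrally symmetric convex body $K\subset\mathbb R^n$ one has $\operatorname{vol} K\cdot\operatorname{vol} K^\circ\ge \frac{4^n}{n!}$. Moreover, if (a) holds, then for every $n\ge1$ and every convex body $X\subset\mathbb R^{2n}$ with $X^\omega=X$ one has $$\operatorname{vol} X\ge \frac{2^n}{n!}.$$
   Context: A convex body is a compact convex set with nonempty interior; it is centrally symmetric if $K=-K$. A sequence $(c_n)$ of positive reals is sub-exponential if $c_n^{1/n}\to 1$ as $n\to\infty$. For a convex body $K\subset\mathbb R^n$ with the origin in its interior, $K^\circ=\{y\in\mathbb R^n : x\cdot y\le 1 \ \forall x\in K\}$ is the Euclidean polar. Let $\omega$ be the standard symplectic form on $\mathbb R^{2n}$ (with coordinates $q_i,p_i$, $\omega(x,y)=\sum_i (q_i(x)p_i(y)-p_i(x)q_i(y))$). For a convex body $X\subset\mathbb R^{2n}$ with the origin in its interior, its symplectic polar is $X^\omega=\{y\in\mathbb R^{2n} : \omega(x,y)\le 1\ \forall x\in X\}$. $X$ is symplectically self-polar if it contains the origin in its interior and $X=X^\omega$. $\operatorname{vol}$ is Lebesgue measure. *)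

(* Defs.v *)
From HB Require Import structures.
From mathcomp Require Import all_boot all_order all_algebra.
From mathcomp Require Import all_classical all_reals all_analysis.

Set Implicit Arguments.
Unset Strict Implicit.
Unset Printing Implicit Defensive.

Import Order.TTheory GRing.Theory Num.Theory.
Import numFieldNormedType.Exports.

Local Open Scope classical_set_scope.
Local Open Scope ring_scope.

Section lebesgue_tuple.
Context (R : realType).

Local Notation mR := (measurableTypeR R).

Definition cons_pair n (x : mR * n.-tuple mR) : n.+1.-tuple mR :=
  [tuple of x.1 :: x.2].

Definition uncons n (t : n.+1.-tuple mR) : mR * n.-tuple mR :=
  (thead t, [tuple of behead t]).

Lemma cons_pairK n : cancel (@cons_pair n) (@uncons n).
Proof. by move=> [x t]; rewrite /uncons theadE; congr pair; exact/val_inj. Qed.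

Lemma unconsK n : cancel (@uncons n) (@cons_pair n).
Proof. by move=> t; rewrite /cons_pair /= -tuple_eta. Qed.

Lemma measurable_cons_pair n : measurable_fun [set: _] (@cons_pair n).
Proof. exact: (measurable_cons measurable_fst measurable_snd). Qed.

Lemma measurable_uncons n : measurable_fun [set: _] (@uncons n).
Proof.
by apply: measurable_fun_pair; [exact: measurable_tnth|exact: measurable_behead].
Qed.

Section step.
Context (n : nat) (mu : {sigma_finite_measure set (n.-tuple mR) -> \bar R}).

Definition lebesgue_step : set (n.+1.-tuple mR) -> \bar R :=
  pushforward (@lebesgue_measure R \x mu)%E (@cons_pair n).

Let lebesgue_step0 : lebesgue_step set0 = 0%E.
Proof. by rewrite /lebesgue_step /pushforward preimage_set0 measure0. Qed.

Let lebesgue_step_ge0 A : (0 <= lebesgue_step A)%E.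
Proof. by rewrite /lebesgue_step /pushforward; exact: measure_ge0. Qed.

Let lebesgue_step_sigma_additive : semi_sigma_additive lebesgue_step.
Proof.
have mcons A : measurable A -> measurable (@cons_pair n @^-1` A).
  by move=> mA; rewrite -[X in measurable X]setTI; exact: measurable_cons_pair.
move=> F mF tF mUF; rewrite /lebesgue_step /pushforward preimage_bigcup.
apply: measure_semi_sigma_additive => [i||]; first exact: mcons.
- apply/trivIsetP => /= i j _ _ ij; rewrite -preimage_setI.
  by move/trivIsetP : tF => /(_ _ _ _ _ ij) -> //; rewrite preimage_set0.
- by rewrite -preimage_bigcup; exact: mcons.
Qed.

HB.instance Definition _ := isMeasure.Build _ _ _ lebesgue_step
  lebesgue_step0 lebesgue_step_ge0 lebesgue_step_sigma_additive.

Let lebesgue_step_sigma_finite : sigma_finite [set: _] lebesgue_step.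
Proof.
have /sigma_finiteP[F [FT ndF Foo]] := sigma_finiteT (@lebesgue_measure R).
have /sigma_finiteP[G [GT ndG Goo]] := sigma_finiteT mu.
exists (fun k => @uncons n @^-1` (F k `*` G k)).
  rewrite -preimage_bigcup -[LHS](preimage_setT (@uncons n)).
  congr (_ @^-1` _); rewrite -setXTT FT GT predeqE => -[x y]; split.
    move=> [/= [i _ Fix] [j _ Gjy]]; exists (maxn i j) => //; split.
    - by move: x Fix; exact/subsetPset/ndF/leq_maxl.
    - by move: y Gjy; exact/subsetPset/ndG/leq_maxr.
  by move=> [i _ []/= ? ?]; split; exists i.
move=> k; have [mF ?] := Foo k; have [mG ?] := Goo k; split.
  by rewrite -[X in measurable X]setTI; apply: measurable_uncons => //;
    exact: measurableX.
rewrite /lebesgue_step /pushforward -comp_preimage (_ : _ \o _ = id); last first.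
  by apply/funext => x /=; rewrite cons_pairK.
by rewrite product_measure1E// lte_mul_pinfty// ge0_fin_numE.
Qed.

HB.instance Definition _ := Measure_isSigmaFinite.Build _ _ _
  lebesgue_step lebesgue_step_sigma_finite.

End step.

(* n-fold product of the one-dimensional Lebesgue measure, on the Borel sets of
   R^n; convex bodies and their polars are closed, hence Borel. *)
Fixpoint lebesgue_tuple n : {sigma_finite_measure set (n.-tuple mR) -> \bar R} :=
  match n with
  | 0 => @dirac _ _ [tuple] R
  | m.+1 => lebesgue_step (lebesgue_tuple m)
  end.

End lebesgue_tuple.

Section convex_bodies.
Context (R : realType).

Definition row_of_tuple n (t : n.-tuple R) : 'rV[R]_n := \row_i tnth t i.

Definition vol n (A : set 'rV[R]_n) : \bar R :=
  lebesgue_tuple R n (@row_of_tuple n @^-1` A).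

Definition convex_body n (K : set 'rV[R]_n) : Prop :=
  [/\ compact K, convex_set K & interior K !=set0].

Definition centrally_symmetric n (K : set 'rV[R]_n) : Prop :=
  [set - x | x in K] = K.

Definition dot n (x y : 'rV[R]_n) : R := \sum_(i < n) x 0 i * y 0 i.

Definition polar n (K : set 'rV[R]_n) : set 'rV[R]_n :=
  [set y | forall x, K x -> dot x y <= 1].

(* A point of R^{2n} is a row (q_1, ..., q_n, p_1, ..., p_n). *)
Definition coord_q n (x : 'rV[R]_(n + n)) (i : 'I_n) : R := x 0 (lshift n i).
Definition coord_p n (x : 'rV[R]_(n + n)) (i : 'I_n) : R := x 0 (rshift n i).

Definition omega n (x y : 'rV[R]_(n + n)) : R :=
  \sum_(i < n) (coord_q x i * coord_p y i - coord_p x i * coord_q y i).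

Definition symplectic_polar n (X : set 'rV[R]_(n + n)) : set 'rV[R]_(n + n) :=
  [set y | forall x, X x -> omega x y <= 1].

Definition self_polar_body n (X : set 'rV[R]_(n + n)) : Prop :=
  [/\ convex_body X, interior X 0 & symplectic_polar X = X].

(* The sequence is indexed by n >= 1; the value c 0 is irrelevant. *)
Definition subexponential (c : R^nat) : Prop :=
  (forall n, (0 < n)%N -> 0 < c n) /\
  (c n `^ n%:R^-1 @[n --> \oo] --> (1 : R)).

Definition subexp_self_polar_bound : Prop :=
  exists2 c : R^nat, subexponential c &
    forall n (X : set 'rV[R]_(n + n)), (0 < n)%N -> self_polar_body X ->
      ((c n * (2 ^+ n / n`!%:R))%:E <= vol X)%E.

Definition symmetric_Mahler_conjecture : Prop :=
  forall n (K : set 'rV[R]_n), (0 < n)%N ->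
    convex_body K -> centrally_symmetric K ->
    ((4 ^+ n / n`!%:R)%:E <= vol K * vol (polar K))%E.

End convex_bodies.

(* Main.v *)
(* (b) => (a): a body X equal to its symplectic polar is centrally symmetric and
   its Euclidean polar is a rotation of X, so Mahler's inequality in dimension 2n
   gives (vol X)^2 >= 16^n / (2n)! >= (2^n / n!)^2; this is also the final claim.

   (a) => (b): for a symmetric K with norm |.|, whose dual norm is |.|*, the body
   { |q|^2 + |p|*^2 <= 1 } is symplectically self-polar.  Cutting it into N shells
   i/N <= |q| <= (i+1)/N bounds its volume by
   N (1/2 + 1/N)^d vol K vol K', where K' is the polar and d the dimension, because
   t sqrt(1 - t^2) <= 1/2.  Hence vol K vol K' >= c_d 4^d / (d! N (1 + 2/N)^d).
   Applied to K^m in dimension d = m n, whose polar is the l1-sum of m copies of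
   K', of volume at most (n! vol K')^m / (m n)!, this reads
   c_(mn) 4^(mn) <= N (1 + 2/N)^(mn) (n! vol K vol K')^m.
   Taking m-th roots, m -> oo and then N -> oo removes the loss. *)

Require Import Defs.
From mathcomp Require Import all_boot all_order all_algebra.
From mathcomp Require Import all_classical all_reals all_analysis.
From mathcomp Require Import measurable_realfun ring lra zify.

Set Implicit Arguments.
Unset Strict Implicit.
Unset Printing Implicit Defensive.

Import Order.TTheory GRing.Theory Num.Theory.
Import numFieldNormedType.Exports.

Local Open Scope classical_set_scope.
Local Open Scope ring_scope.

(* Bundles the side condition that the canonical measure structure on
   [pushforward] leaves as an existential variable. *)
Definition image_measure d d' (T1 : measurableType d) (T2 : measurableType d')
    (R : realFieldType) (m : {measure set T1 -> \bar R}) (f : T1 -> T2)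
    (mf : measurable_fun [set: T1] f) : {measure set T2 -> \bar R} :=
  measure_function_pushforward__canonical__measure_function_Measure m mf.

(** * Lebesgue measure on row vectors *)

Section borel.
Context {R : realType}.
Local Notation mR := (measurableTypeR R).
Local Notation leb := (@lebesgue_measure R).

Definition borel n (A : set 'rV[R]_n) :=
  measurable (@row_of_tuple R n @^-1` A : set (n.-tuple mR)).

Lemma borelI n (A B : set 'rV[R]_n) : borel A -> borel B -> borel (A `&` B).
Proof. exact: measurableI. Qed.

Lemma borelC n (A : set 'rV[R]_n) : borel A -> borel (~` A).
Proof. exact: measurableC. Qed.

Lemma borelD n (A B : set 'rV[R]_n) : borel A -> borel B -> borel (A `\` B).
Proof. exact: measurableD. Qed.

Lemma borel_bigcup n (T : countType) (F : T -> set 'rV[R]_n) :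
  (forall i, borel (F i)) -> borel (\bigcup_i F i).
Proof.
move=> mF; rewrite /borel preimage_bigcup.
by apply: countable_bigcupT_measurable => //; exact: countableP.
Qed.

Lemma borel_coord n (i : 'I_n) (Y : set R) : measurable (Y : set mR) ->
  borel [set x : 'rV_n | Y (x 0 i)].
Proof.
move=> mY; rewrite /borel (_ : _ @^-1` _ = (fun t => tnth t i) @^-1` Y).
  by rewrite -[X in measurable X]setTI; exact: measurable_tnth.
by apply/funext => t /=; rewrite mxE.
Qed.

Lemma borel_ball n (x : 'rV[R]_n) (e : R) : borel (ball x e).
Proof.
have [e0|e0] := ltP 0 e; last first.
  rewrite (_ : ball x e = set0); first exact: measurable0.
  by apply/seteqP; split => // y [] e1 _; move: e0; rewrite leNgt e1.
rewrite (_ : ball x e =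
    \bigcap_(i in [set: 'I_n]) [set y : 'rV_n | ball (x 0 i) e (y 0 i)]).
  rewrite /borel preimage_bigcap; apply: fin_bigcap_measurable => // i _.
  by apply: borel_coord; exact: measurable_ball.
apply/seteqP; split => y; first by move=> [_ h] i _; exact: h.
by move=> h; split=> // i j; rewrite ord1; exact: h.
Qed.

(** Links the sup-norm topology of rows to the product sigma-algebra of tuples: [U] is the countable
    union of the balls inside it with rational centre and radius [k.+1^-1], and each ball is a
    finite intersection of coordinate conditions. *)
Lemma borel_open n (U : set 'rV[R]_n) : open U -> borel U.
Proof.
move=> oU.
pose F (q : 'rV[rat]_n * nat) : set 'rV[R]_n :=
  [set y | let B := ball (map_mx ratr q.1 : 'rV[R]_n) (q.2.+1%:R^-1 : R) in
           B `<=` U /\ B y].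
have -> : U = \bigcup_q F q.
  apply/seteqP; split => [x Ux|x [q _ [BU]]]; last exact: BU.
  have [e /= e0 xeU] : exists2 e : R, 0 < e & ball x e `<=` U.
    by have /nbhs_ballP := open_nbhs_nbhs (conj oU Ux).
  have [k _ ke] : exists2 k, True & k.+1%:R^-1 < e / 2.
    have [N _ /(_ N (leqnn _)) /= hN] :=
      near_infty_natSinv_lt (PosNum (divr_gt0 e0 (ltr0n _ 2))).
    by exists N.
  have /choice[f fP] (i : 'I_n) :
      exists q : rat, ball (x 0 i) k.+1%:R^-1 (ratr q).
    have [|q] := @rat_in_itvoo R (x 0 i - k.+1%:R^-1) (x 0 i + k.+1%:R^-1).
      by rewrite ltrD2l gtrN// invr_gt0.
    by rewrite in_itv /= => qx; exists q; rewrite /ball /= ltr_distlC.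
  have xq : ball x k.+1%:R^-1 (map_mx ratr (\row_i f i) : 'rV[R]_n).
    by split=> [|i j]; rewrite ?invr_gt0// ord1 !mxE; exact: fP.
  exists (\row_i f i, k) => //=; split; last exact: ball_sym.
  move=> y qy; apply: xeU; rewrite (splitr e).
  exact: ball_triangle (le_ball (ltW ke) xq) (le_ball (ltW ke) qy).
apply: borel_bigcup => q; have [BU|BU] := pselect
    (ball (map_mx ratr q.1 : 'rV[R]_n) q.2.+1%:R^-1 `<=` U).
  rewrite (_ : F q = ball (map_mx ratr q.1 : 'rV[R]_n) q.2.+1%:R^-1).
    exact: borel_ball.
  by apply/seteqP; split => y; [case|].
rewrite (_ : F q = set0); first exact: measurable0.
by apply/seteqP; split => y // [].
Qed.

Lemma borel_closed n (A : set 'rV[R]_n) : closed A -> borel A.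
Proof.
move=> cA; rewrite -[A]setCK.
by apply: borelC; apply: borel_open; exact: closed_openC.
Qed.

Lemma vol_le n (A B : set 'rV[R]_n) : borel A -> borel B -> A `<=` B ->
  (vol A <= vol B)%E.
Proof.
by move=> mA mB AB; apply: le_measure; rewrite ?inE// => t; exact: AB.
Qed.

Lemma vol_ge0 n (A : set 'rV[R]_n) : (0 <= vol A)%E.
Proof. exact: measure_ge0. Qed.

Definition cons_row n (x : R) (y : 'rV[R]_n) : 'rV[R]_n.+1 :=
  \row_i (if unlift ord0 i is Some j then y 0 j else x).

Definition slice n (A : set 'rV[R]_n.+1) (x : R) : set 'rV[R]_n :=
  cons_row x @^-1` A.

Lemma row_of_cons n (x : R) (t : n.-tuple R) :
  row_of_tuple [tuple of x :: t] = cons_row x (row_of_tuple t).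
Proof.
apply/rowP => i; rewrite !mxE; case: unliftP => [j|] -> //.
by rewrite tnthS mxE.
Qed.

Lemma xsection_cons n (A : set 'rV[R]_n.+1) (x : R) :
  xsection (@cons_pair R n @^-1` (@row_of_tuple R n.+1 @^-1` A)) x =
  @row_of_tuple R n @^-1` (slice A x).
Proof.
apply/seteqP; split => t; rewrite xsectionE /slice /= row_of_cons //.
Qed.

(** Cavalieri's principle, immediate from the recursive construction of the measure as a product;
    the inductions on the dimension rest on it. *)
Lemma vol_slice n (A : set 'rV[R]_n.+1) :
  vol A = (\int[leb]_x vol (slice A x))%E.
Proof.
rewrite /vol /= /lebesgue_step /pushforward /product_measure1.
by apply: eq_integral => x _ /=; rewrite xsection_cons.
Qed.

Lemma measurable_cons_preimage n (A : set 'rV[R]_n.+1) : borel A ->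
  measurable (@cons_pair R n @^-1` (@row_of_tuple R n.+1 @^-1` A)).
Proof.
by move=> mA; rewrite -[X in measurable X]setTI; exact: measurable_cons_pair.
Qed.

Lemma borel_slice n (A : set 'rV[R]_n.+1) x : borel A -> borel (slice A x).
Proof.
move=> /measurable_cons_preimage mA.
by rewrite /borel -xsection_cons; exact: measurable_xsection.
Qed.

Lemma measurable_vol_slice n (A : set 'rV[R]_n.+1) : borel A ->
  measurable_fun [set: mR] (fun x => vol (slice A x)).
Proof.
move=> /measurable_cons_preimage mA.
apply: eq_measurable_fun (measurable_fun_xsection (lebesgue_tuple R n) mA).
by move=> x _ /=; rewrite xsection_cons.
Qed.

Lemma lsubmx_cons_row a b (x : R) (y : 'rV[R]_(a + b)) :
  lsubmx (cons_row x y : 'rV_(a.+1 + b)) = cons_row x (lsubmx y).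
Proof.
apply/rowP => i; rewrite !mxE; case: (unliftP ord0 i) => [j|] ->.
  have -> : lshift b (lift ord0 j : 'I_a.+1) =
      lift (ord0 : 'I_(a + b).+1) (lshift b (j : 'I_a)) :> 'I_(a + b).+1.
    exact: val_inj.
  by rewrite liftK mxE.
have -> : lshift b (ord0 : 'I_a.+1) = ord0 :> 'I_(a + b).+1 by exact: val_inj.
by rewrite unlift_none.
Qed.

Lemma rsubmx_cons_row a b (x : R) (y : 'rV[R]_(a + b)) :
  rsubmx (cons_row x y : 'rV_(a.+1 + b)) = rsubmx y.
Proof.
apply/rowP => i; rewrite !mxE.
have -> : rshift a.+1 i = lift (ord0 : 'I_(a + b).+1) (rshift a i)
  :> 'I_(a + b).+1 by exact: val_inj.
by rewrite liftK.
Qed.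

Definition prod_set a b (A : set 'rV[R]_a) (B : set 'rV[R]_b) :
  set 'rV[R]_(a + b) := [set x | A (lsubmx x) /\ B (rsubmx x)].

Lemma vol_prod a b (A : set 'rV[R]_a) (B : set 'rV[R]_b) :
  borel A -> borel B -> vol (prod_set A B) = (vol A * vol B)%E.
Proof.
elim: a A => [|a IH] A mA mB.
  (* In dimension 0 the only point is [0], so [A] is everything or empty and its Dirac mass is 1 or
     0. *)
  have [A0|A0] := pselect (A 0).
    rewrite (_ : prod_set A B = B).
      rewrite {2}/vol /= diracE mem_set ?mul1e//=.
      by rewrite (_ : row_of_tuple _ = 0)//; apply/rowP => -[].
    apply/seteqP; split => x; rewrite /prod_set /=.
      by move=> [_]; rewrite (_ : rsubmx x = x)//; apply/rowP => i;
        rewrite mxE; congr (x _ _); exact: val_inj.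
    rewrite (_ : lsubmx x = 0); last by apply/rowP => -[].
    by rewrite (_ : rsubmx x = x)//; apply/rowP => i;
        rewrite mxE; congr (x _ _); exact: val_inj.
  rewrite (_ : prod_set A B = set0).
    rewrite {1 2}/vol preimage_set0 measure0 /= diracE memNset ?mul0e//=.
    by rewrite (_ : row_of_tuple _ = 0)//; apply/rowP => -[].
  apply/seteqP; split => x //; rewrite /prod_set /= => -[].
  by rewrite (_ : lsubmx x = 0)//; apply/rowP => -[].
rewrite [LHS]vol_slice [in RHS]vol_slice.
rewrite -(ge0_integralZr _ measurableT (measurable_vol_slice mA))//.
apply: eq_integral => x _; rewrite -IH//; last exact: borel_slice.
congr vol; rewrite /slice /prod_set predeqE => y /=.
by rewrite lsubmx_cons_row rsubmx_cons_row.
Qed.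

Definition tuple_of_row n (x : 'rV[R]_n) : n.-tuple mR := [tuple x 0 i | i < n].

Lemma tuple_of_rowK n : cancel (@tuple_of_row n) (@row_of_tuple R n).
Proof. by move=> x; apply/rowP => i; rewrite mxE tnth_mktuple. Qed.

Lemma row_of_tupleK n : cancel (@row_of_tuple R n) (@tuple_of_row n).
Proof. by move=> t; apply: eq_from_tnth => i; rewrite tnth_mktuple mxE. Qed.

Definition measurable_row a b (f : 'rV[R]_a -> 'rV[R]_b) := forall i,
  measurable_fun [set: a.-tuple mR] (fun t => f (row_of_tuple t) 0 i : mR).

Lemma measurable_row_coord a (i : 'I_a) :
  measurable_fun [set: a.-tuple mR] (fun t => row_of_tuple t 0 i : mR).
Proof.
apply: eq_measurable_fun (measurable_tnth i) => t _.
by rewrite mxE.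
Qed.

Lemma measurable_tuple_of_row a b (f : 'rV[R]_a -> 'rV[R]_b) :
  measurable_row f ->
  measurable_fun [set: a.-tuple mR] (fun t => tuple_of_row (f (row_of_tuple t))).
Proof.
move=> mf; apply/measurable_fun_tnthP => i.
by apply: eq_measurable_fun (mf i) => t _ /=; rewrite tnth_mktuple.
Qed.

Lemma borel_preimage a b (f : 'rV[R]_a -> 'rV[R]_b) (B : set 'rV[R]_b) :
  measurable_row f -> borel B -> borel (f @^-1` B).
Proof.
move=> /measurable_tuple_of_row mf mB; rewrite /borel.
rewrite (_ : _ @^-1` _ = (fun t => tuple_of_row (f (row_of_tuple t))) @^-1`
    (@row_of_tuple R b @^-1` B)).
  by rewrite -[X in measurable X]setTI; exact: mf.
by apply/funext => t /=; rewrite tuple_of_rowK.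
Qed.

Lemma measurable_row_lsubmx a b : measurable_row (@lsubmx R 1 a b).
Proof.
move=> i; apply: eq_measurable_fun (measurable_row_coord (lshift b i)).
by move=> t _; rewrite [RHS]mxE.
Qed.

Lemma measurable_row_rsubmx a b : measurable_row (@rsubmx R 1 a b).
Proof.
move=> i; apply: eq_measurable_fun (measurable_row_coord (rshift a i)).
by move=> t _; rewrite [RHS]mxE.
Qed.

Lemma measurable_rowZ a (c : R) : measurable_row (fun x : 'rV[R]_a => c *: x).
Proof.
move=> i; have := measurable_funM (measurable_cst c) (measurable_row_coord i).
by apply: eq_measurable_fun => t _; rewrite [RHS]mxE.
Qed.

Lemma borel_prod a b (A : set 'rV[R]_a) (B : set 'rV[R]_b) :
  borel A -> borel B -> borel (prod_set A B).
Proof.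
move=> mA mB; apply: borelI.
- exact: borel_preimage (@measurable_row_lsubmx _ _) mA.
- exact: borel_preimage (@measurable_row_rsubmx _ _) mB.
Qed.

(** For a positive factor [d], [d] times the pushforward agrees with Lebesgue measure on half-open
    intervals, hence everywhere by uniqueness; a negative factor is reduced to this by
    reflection. *)
Lemma lebesgue_measureZ (c : R) (A : set mR) : c != 0 -> measurable A ->
  leb ( *%R c @^-1` A) = (`|c|^-1%:E * leb A)%E.
Proof.
have pos (d : R) (B : set mR) : 0 < d -> measurable B ->
    leb ( *%R d @^-1` B) = (d^-1%:E * leb B)%E.
  move=> d0 mB.
  have md : measurable_fun [set: mR] ( *%R d : mR -> mR).
    exact: measurable_funM (measurable_cst d) (@measurable_id _ _ _).
  have -> : leb B = (d%:E * pushforward leb ( *%R d : mR -> mR) B)%E.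
    have dn : 0 <= d by exact: ltW.
    rewrite -[RHS]/(mscale (NngNum dn) (image_measure leb md) B).
    apply: lebesgue_measure_unique mB => _ [[a b] _ <-].
    transitivity (d%:E * leb `](d^-1 * a)%R, (d^-1 * b)%R]%classic)%E; last first.
      congr (_ * leb _)%E; apply/seteqP.
      by split => x /=; rewrite !in_itv /= ltr_pdivrMl// ler_pdivlMl.
    rewrite !lebesgue_measure_itv /= !lte_fin ltr_pM2l ?invr_gt0//.
    case: ifP => _; last by rewrite mule0.
    by rewrite -!EFinB -EFinM -mulrBr mulVKf// gt_eqF.
  by rewrite muleA -EFinM mulVf ?gt_eqF// mul1e.
move=> c0 mA; have [c1|c1|c1] := ltgtP c 0; last by rewrite c1 eqxx in c0.
- have mNA : measurable (-%R @^-1` A : set mR).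
    rewrite -[X in measurable X]setTI; exact: (@oppr_measurable R setT).
  rewrite (ltr0_norm c1) -(lebesgue_measureN mA) /pushforward -pos ?oppr_gt0//.
  by congr (leb _); apply/funext => x /=; rewrite mulNr opprK.
- by rewrite (gtr0_norm c1); exact: pos.
Qed.

Lemma volZ n (c : R) (A : set 'rV[R]_n) : c != 0 -> borel A ->
  vol [set x | A (c *: x)] = ((`|c|^-1 ^+ n)%:E * vol A)%E.
Proof.
move=> c0; elim: n A => [|n IH] A mA.
  rewrite expr0 mul1e; congr vol; apply/funext => x /=.
  by congr A; apply/rowP => -[].
rewrite !vol_slice.
transitivity (\int[leb]_x ((`|c|^-1 ^+ n)%:E * vol (slice A (c * x))))%E.
  apply: eq_integral => x _; rewrite -IH; last exact: borel_slice.
  congr vol; apply/funext => y /=; rewrite /slice /=; congr A.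
  by apply/rowP => i; rewrite !mxE; case: (unlift _ _) => [j|//]; rewrite mxE.
rewrite (@ge0_integralZl _ _ _ leb _ measurableT)//; last first.
  have := measurableT_comp (measurable_vol_slice mA)
    (measurable_funM (measurable_cst c) (@measurable_id _ _ [set: mR])).
  exact.
have mc : measurable_fun [set: mR] ( *%R c : mR -> mR).
  exact: measurable_funM (measurable_cst c) (@measurable_id _ _ _).
have c1 : 0 <= `|c|^-1 by rewrite invr_ge0.
rewrite exprSr EFinM -muleA; congr (_ * _)%E.
(* The remaining one-dimensional substitution is a change of measure: the pushforward of [leb] by
   [c] is [leb] scaled by the inverse of [|c|]. *)
transitivity (\int[mscale (NngNum c1) leb]_x vol (slice A x))%E; last first.
  by rewrite ge0_integral_mscale//; exact: measurable_vol_slice.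
transitivity (\int[image_measure leb mc]_x vol (slice A x))%E; last first.
  by apply: eq_measure_integral => B mB _; exact: lebesgue_measureZ.
by rewrite (ge0_integral_pushforward mc)//; exact: measurable_vol_slice.
Qed.

(* The pushforward of Lebesgue measure by [(f, g)] is characterized by its values
   on rectangles. *)
Lemma vol_rearrange a b (f : 'rV[R]_(a + b) -> 'rV[R]_a)
    (g : 'rV[R]_(a + b) -> 'rV[R]_b) (S : set 'rV[R]_(a + b)) :
  measurable_row f -> measurable_row g ->
  (forall A B, borel A -> borel B ->
     vol [set x | A (f x) /\ B (g x)] = (vol A * vol B)%E) ->
  borel S -> vol [set x | S (row_mx (f x) (g x))] = vol S.
Proof.
move=> mf mg vol_fg mS.
pose phi (f : 'rV[R]_(a + b) -> 'rV[R]_a) (g : 'rV[R]_(a + b) -> 'rV[R]_b) t :=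
  (tuple_of_row (f (row_of_tuple t)), tuple_of_row (g (row_of_tuple t))).
pose psi (p : a.-tuple mR * b.-tuple mR) :=
  tuple_of_row (row_mx (row_of_tuple p.1) (row_of_tuple p.2)).
have mphi f' g' : measurable_row f' -> measurable_row g' ->
    measurable_fun [set: (a + b).-tuple mR] (phi f' g').
  by move=> mf' mg'; apply: measurable_fun_pair;
    exact: measurable_tuple_of_row.
have mpsi : measurable_fun [set: a.-tuple mR * b.-tuple mR] psi.
  apply/measurable_fun_tnthP => i.
  case: (splitP i) => j ij.
  - apply: eq_measurable_fun (measurableT_comp (measurable_tnth j) measurable_fst).
    move=> p _ /=; rewrite tnth_mktuple.
    by rewrite (_ : i = lshift b j) ?row_mxEl ?mxE//; exact: val_inj.
  - apply: eq_measurable_fun (measurableT_comp (measurable_tnth j) measurable_snd).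
    move=> p _ /=; rewrite tnth_mktuple.
    by rewrite (_ : i = rshift a j) ?row_mxEr ?mxE//; exact: val_inj.
have mX : measurable (psi @^-1` (@row_of_tuple R (a + b) @^-1` S)).
  by rewrite -[X in measurable X]setTI; exact: mpsi.
have prodE (f' : 'rV[R]_(a + b) -> 'rV[R]_a) (g' : 'rV[R]_(a + b) -> 'rV[R]_b)
      (mf' : measurable_row f') (mg' : measurable_row g') :
    (forall A B, borel A -> borel B ->
      vol [set x | A (f' x) /\ B (g' x)] = (vol A * vol B)%E) ->
    (lebesgue_tuple R a \x lebesgue_tuple R b)%E
      (psi @^-1` (@row_of_tuple R (a + b) @^-1` S)) =
    vol [set x | S (row_mx (f' x) (g' x))].
  move=> H.
  transitivity (image_measure (lebesgue_tuple R (a + b)) (mphi _ _ mf' mg')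
      (psi @^-1` (@row_of_tuple R (a + b) @^-1` S))).
    apply: product_measure_unique mX => A B mA mB.
    have rowK n (C : set (n.-tuple mR)) :
        @row_of_tuple R n @^-1` (@tuple_of_row n @^-1` C) = C.
      by apply/funext => t /=; rewrite row_of_tupleK.
    have := H (@tuple_of_row a @^-1` A) (@tuple_of_row b @^-1` B).
    by rewrite /borel /vol !rowK => /(_ mA mB) <-.
  congr (lebesgue_tuple _ _ _); apply/funext => t.
  by rewrite /psi /phi /= !tuple_of_rowK.
(* Both [(f, g)] and the identity splitting [(lsubmx, rsubmx)] push the measure forward to the same
   product measure. *)
rewrite -(prodE f g)// (prodE lsubmx rsubmx).
- by congr vol; apply/funext => x /=; rewrite hsubmxK.
- exact: measurable_row_lsubmx.
- exact: measurable_row_rsubmx.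
- exact: vol_prod.
Qed.

End borel.

(** * Finiteness and covering bounds for volumes, and the quarter turn *)

Section volume.
Context {R : realType}.
Local Notation mR := (measurableTypeR R).
Local Notation leb := (@lebesgue_measure R).

Lemma vol_bigcup_le n N (A : set 'rV[R]_n) (F : nat -> set 'rV[R]_n) :
  borel A -> (forall i, borel (F i)) ->
  (forall x, A x -> exists2 i, (i < N)%N & F i x) ->
  (vol A <= \sum_(i < N) vol (F i))%E.
Proof.
move=> mA mF AF.
pose G i := @row_of_tuple R n @^-1` F i.
apply: (@content_subadditive _ _ _ (lebesgue_tuple R n) _ G N).
- by move=> i _; exact: mF.
- exact: mA.
- by move=> t At; have [i iN Fi] := AF _ At; rewrite -bigcup_mkord; exists i.
Qed.

Lemma volD n (A B : set 'rV[R]_n) : borel A -> borel B -> B `<=` A ->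
  (vol B < +oo)%E -> vol (A `\` B) = (vol A - vol B)%E.
Proof.
move=> mA mB BA Boo; have AE : A = (A `\` B) `|` B by rewrite setUC setDUK.
rewrite {2}AE /vol preimage_setU measureU//; last 2 first.
- exact: borelD.
- by rewrite -preimage_setI setDKI preimage_set0.
by rewrite addeK// ge0_fin_numE.
Qed.

Definition box n (M : R) : set 'rV[R]_n := [set x | forall i, `|x 0 i| <= M].

Lemma borel_box n M : borel (@box n M).
Proof.
rewrite (_ : @box n M = \bigcap_(i in [set: 'I_n]) [set y : 'rV_n | `|y 0 i| <= M]).
  rewrite /borel preimage_bigcap; apply: fin_bigcap_measurable => // i _.
  apply: (borel_coord _ (Y := [set x | `|x| <= M])).
  rewrite (_ : mkset _ = `[- M, M]%classic); first exact: measurable_itv.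
  by apply/seteqP; split => x; rewrite /= in_itv /= ler_norml.
by apply/seteqP; split => y h i; [move=> _; exact: h|exact: h].
Qed.

Lemma vol_box n M : 0 <= M -> vol (@box n M) = ((M *+ 2) ^+ n)%:E.
Proof.
move=> M0; elim: n => [|n IH].
  rewrite (_ : @box 0 M = setT); last by apply/seteqP; split => x // _ [].
  by rewrite /vol /= preimage_setT diracT expr0.
rewrite vol_slice.
transitivity (\int[leb]_(x in `[(- M)%R, M]%classic) vol (@box n M))%E.
  rewrite [RHS]integral_mkcond; apply: eq_integral => x _.
  rewrite patchE mem_setE in_itv /= -ler_norml; case: ifPn => xM.
    congr vol; apply/seteqP; split => y; rewrite /slice /= => h i.
      by have := h (lift ord0 i); rewrite mxE liftK.
    by rewrite mxE; case: unliftP => [j _|_]; [exact: h|].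
  rewrite (_ : slice _ _ = set0); first by rewrite /vol preimage_set0 measure0.
  apply/seteqP; split => y //; rewrite /slice /= => /(_ ord0).
  by rewrite mxE unlift_none (negbTE xM).
rewrite IH integral_cst ?measurable_itv//= lebesgue_measure_itv /= lte_fin.
have [MM|MM] := ltP.
  by rewrite exprSr EFinM -EFinB opprK mulr2n.
have -> : M = 0 by apply/eqP; rewrite eq_le M0 andbT; move: MM; lra.
by rewrite mule0 mul0rn exprS mul0r.
Qed.

Lemma coord_le_norm n (x : 'rV[R]_n) i : `|x 0 i| <= `|x|.
Proof.
rewrite -[`|x|]/(mx_norm x) mx_normrE; apply/bigmax_geP; right.
by exists (0, i).
Qed.

Lemma vol_lty n (A : set 'rV[R]_n) M : borel A ->
  (forall x, A x -> `|x| <= M) -> (vol A < +oo)%E.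
Proof.
move=> mA AM.
have M0 : 0 <= Num.max M 0 by rewrite le_max lexx orbT.
apply: le_lt_trans (vol_le mA (@borel_box n (Num.max M 0)) _) _.
  move=> x /AM xM i; rewrite le_max; apply/orP; left; apply: le_trans xM.
  exact: coord_le_norm.
by rewrite vol_box ?ltry.
Qed.

(** The quarter turn [(q, p) -> (p, -q)] exchanges the factors of a rectangle and reflects one of
    them, so it preserves volumes of rectangles. *)
Lemma vol_rotate n (S : set 'rV[R]_(n + n)) : borel S ->
  vol [set x | S (row_mx (rsubmx x) (- lsubmx x))] = vol S.
Proof.
move=> mS; apply: (@vol_rearrange R n n rsubmx (fun x => - lsubmx x)) => //.
- exact: measurable_row_rsubmx.
- move=> i; have := measurableT_comp (@oppr_measurable R setT)
    (@measurable_row_lsubmx R n n i).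
  by apply: eq_measurable_fun => t _; rewrite /= [RHS]mxE.
- move=> A B mA mB.
  have N1 : (-1 : R) != 0 by rewrite oppr_eq0 oner_eq0.
  have mNB : borel [set x | B (-1 *: x)].
    exact: borel_preimage (@measurable_rowZ _ _ _) mB.
  (* A factor 1 is expanded to the n-th power of the inverse of [|-1|], the form in which [volZ]
     absorbs the reflection of [B]. *)
  rewrite muleC -[in RHS](mul1e (vol B)) -[X in X%:E](expr1n _ n) -{1}(invr1 R).
  rewrite -{1}(normrN1 R) -volZ// -vol_prod//; congr vol.
  apply/funext => x; rewrite /prod_set /= scaleN1r.
  by apply/propext; split => -[].
Qed.

End volume.

(** * Polarity *)

Section dot_product.
Context {R : realType} {n : nat}.
Implicit Types (x y z : 'rV[R]_n) (c : R) (K : set 'rV[R]_n).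

Lemma dotC x y : dot x y = dot y x.
Proof. by apply: eq_bigr => i _; rewrite mulrC. Qed.

Lemma dotDl x y z : dot (x + y) z = dot x z + dot y z.
Proof. by rewrite -big_split; apply: eq_bigr => i _; rewrite mxE mulrDl. Qed.

Lemma dotZl c x y : dot (c *: x) y = c * dot x y.
Proof. by rewrite [RHS]mulr_sumr; apply: eq_bigr => i _; rewrite mxE mulrA. Qed.

Lemma dotNl x y : dot (- x) y = - dot x y.
Proof. by rewrite -scaleN1r dotZl mulN1r. Qed.

Lemma dotBl x y z : dot (x - y) z = dot x z - dot y z.
Proof. by rewrite dotDl dotNl. Qed.

Lemma dot0l y : dot 0 y = 0.
Proof. by rewrite -(scale0r 0) dotZl mul0r. Qed.

Lemma dotDr x y z : dot z (x + y) = dot z x + dot z y.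
Proof. by rewrite dotC dotDl !(dotC z). Qed.

Lemma dotZr c x y : dot y (c *: x) = c * dot y x.
Proof. by rewrite dotC dotZl !(dotC y). Qed.

Lemma dotNr x y : dot y (- x) = - dot y x.
Proof. by rewrite dotC dotNl !(dotC y). Qed.

Lemma dotBr x y z : dot z (x - y) = dot z x - dot z y.
Proof. by rewrite dotDr dotNr. Qed.

Lemma dot_ge0 x : 0 <= dot x x.
Proof. by apply: sumr_ge0 => i _; rewrite -expr2 sqr_ge0. Qed.

Lemma dot_eq0 x : dot x x = 0 -> x = 0.
Proof.
move=> /eqP; rewrite psumr_eq0; last by move=> i _; rewrite -expr2 sqr_ge0.
move=> /allP x0; apply/rowP => i; rewrite mxE; apply/eqP.
by have := x0 i (mem_index_enum i); rewrite mulf_eq0 orbb.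
Qed.

Lemma dot_delta i x : dot (delta_mx 0 i) x = x 0 i.
Proof.
rewrite /dot (bigD1 i)//= mxE !eqxx mul1r big1 ?addr0// => j ji.
by rewrite mxE (negbTE ji) andbF mul0r.
Qed.

Lemma dot_norm_le x y : `|dot x y| <= n%:R * (`|x| * `|y|).
Proof.
apply: le_trans (ler_norm_sum _ _ _) _.
rewrite mulr_natl -[X in _ *+ X](card_ord n) -sumr_const.
by apply: ler_sum => i _; rewrite normrM ler_pM// coord_le_norm.
Qed.

Lemma norm_leP x c : 0 <= c -> (forall i, `|x 0 i| <= c) -> `|x| <= c.
Proof.
move=> c0 xc; rewrite -[`|x|]/(mx_norm x) mx_normrE; apply/bigmax_leP.
by split=> // -[i j] _ /=; rewrite ord1.
Qed.

Lemma dot_continuous (T : topologicalType) (f g : T -> 'rV[R]_n) :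
  continuous f -> continuous g -> continuous (fun t => dot (f t) (g t)).
Proof.
move=> cf cg t; rewrite /continuous_at /dot; apply: (cvg_big add_continuous) => i _.
apply: cvgM.
- exact: (continuous_comp (cf t) (@coord_continuous _ _ _ _ _ _)).
- exact: (continuous_comp (cg t) (@coord_continuous _ _ _ _ _ _)).
Qed.

Lemma dot_continuousl y : continuous (fun x => dot x y).
Proof.
by apply: (@dot_continuous _ id (cst y)) => t; [exact: cvg_id|exact: cst_continuous].
Qed.

Lemma dot_continuousr y : continuous (dot y).
Proof.
by apply: (@dot_continuous _ (cst y) id) => t; [exact: cst_continuous|exact: cvg_id].
Qed.

Lemma closed_bounded_compact K M : closed K -> (forall x, K x -> `|x| <= M) ->
  compact K.
Proof.
move=> cK KM; apply: bounded_closed_compact => //.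
exists M; split; first exact: num_real.
by move=> N MN x Kx; apply: le_trans (KM x Kx) (ltW MN).
Qed.

(** Sublevel set of the support function of [K]. For positive [c] it is a dilate of the polar; the
    shells below are cut out by such sets. *)
Definition hpolar K c : set 'rV[R]_n := [set y | forall x, K x -> dot x y <= c].

Lemma closed_le_family (T : topologicalType) (I : Type) (D : set I)
  (f : I -> T -> R) c : (forall i, D i -> continuous (f i)) ->
  closed [set t | forall i, D i -> f i t <= c].
Proof.
move=> cf; apply: (@closed_bigI _ _ D (fun i => [set t | f i t <= c])) => i Di.
have /continuous_closedP h := cf i Di.
exact: (h _ (@closed_le R c)).
Qed.

Lemma closed_hpolar K c : closed (hpolar K c).
Proof.
apply: (@closed_le_family _ _ K (fun x y => dot x y)) => x _.
exact: dot_continuousr.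
Qed.

Lemma hpolarZ K c : 0 < c -> hpolar K c = [set y | polar K (c^-1 *: y)].
Proof.
move=> c0; apply/seteqP; split => y /= Ky x Kx.
  by rewrite dotZr ler_pdivrMl// mulr1; exact: Ky.
by have := Ky x Kx; rewrite dotZr ler_pdivrMl// mulr1.
Qed.

Lemma closed_polar K : closed (polar K).
Proof. exact: closed_hpolar. Qed.

Lemma borel_hpolar K c : borel (hpolar K c).
Proof. by apply: borel_closed; exact: closed_hpolar. Qed.

Lemma vol_hpolar K c : 0 < c -> vol (hpolar K c) = ((c ^+ n)%:E * vol (polar K))%E.
Proof.
move=> c0; rewrite hpolarZ// volZ ?invr_eq0 ?gt_eqF//.
  by rewrite normfV gtr0_norm// invrK.
exact: borel_hpolar.
Qed.

Definition is_convex K := forall x y c, K x -> K y -> 0 <= c -> c <= 1 ->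
  K (c *: x + (1 - c) *: y).

Lemma is_convexP K : convex_set K <-> is_convex K.
Proof.
split=> [cK x y c Kx Ky c0 c1|cK x y c].
  by have := cK x y (Itv01 c0 c1) (mem_set Kx) (mem_set Ky); rewrite inE.
by rewrite !inE => Kx Ky; apply: cK.
Qed.

End dot_product.

(** * Symmetric convex bodies, the bipolar theorem, and products *)

Section sym_body.
Context {R : realType}.

Definition sym_body n (K : set 'rV[R]_n) :=
  [/\ compact K, is_convex K, nbhs (0 : 'rV[R]_n) K & forall x, K x -> K (- x)].

Lemma nbhs0_normP n (A : set 'rV[R]_n) :
  nbhs (0 : 'rV[R]_n) A <-> exists2 r, 0 < r & forall x, `|x| <= r -> A x.
Proof.
split=> [/nbhs_ballP[r /= r0 rA]|[r r0 rA]].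
  exists (r / 2); first by rewrite divr_gt0.
  move=> x xr; apply: rA; rewrite mx_norm_ball /ball_/= sub0r normrN.
  by rewrite (le_lt_trans xr)// ltr_pdivrMr// ltr_pMr// ltr1n.
apply/nbhs_ballP; exists r => //= x; rewrite mx_norm_ball /ball_/= sub0r normrN => /ltW.
exact: rA.
Qed.

Lemma compact_norm_bound n (K : set 'rV[R]_n) : compact K ->
  exists2 M, 0 < M & forall x, K x -> `|x| <= M.
Proof.
move=> /compact_bounded/ex_strict_bound_gt0[M M0 KM]; exists M => // x Kx.
exact/ltW/KM.
Qed.

Lemma compact_borel n (K : set 'rV[R]_n) : compact K -> borel K.
Proof.
by move=> cK; apply: borel_closed; apply: compact_closed => //; exact: norm_hausdorff.
Qed.

Lemma compact_vol_lty n (K : set 'rV[R]_n) : compact K -> (vol K < +oo)%E.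
Proof.
move=> cK; have [M _ KM] := compact_norm_bound cK.
exact: vol_lty (compact_borel cK) KM.
Qed.

(** If the ball of radius [r] about [a] lies in [K], so does the ball of radius [r] about the
    origin: [x] is the midpoint of [a + x] and [-(a - x)]. *)
Lemma convex_body_sym n (K : set 'rV[R]_n) : convex_body K ->
  centrally_symmetric K -> sym_body K.
Proof.
move=> [cK /is_convexP xK [a /nbhs_ballP[r /= r0 rK]]] sK.
have KN x : K x -> K (- x) by move=> Kx; rewrite -sK; exists x.
split=> //; apply/nbhs_ballP; exists r => //= x.
rewrite mx_norm_ball /ball_/= sub0r normrN => xr.
have K1 : K (a + x).
  by apply: rK; rewrite mx_norm_ball /ball_/= opprD addrA subrr sub0r normrN.
have K2 : K (- (a - x)).
  by apply: KN; apply: rK; rewrite mx_norm_ball /ball_/= opprB addrC subrK.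
have h : (1 - 2^-1 : R) = 2^-1 by field.
have := xK _ _ (2^-1) K1 K2; rewrite h invr_ge0 ler0n invf_le1// ler1n.
move=> /(_ isT isT); congr K.
by apply/rowP => i; rewrite !mxE; field.
Qed.

(* The nearest point of [K] to a point outside yields a separating
   hyperplane. *)
Lemma bipolar_sub n (K : set 'rV[R]_n) z : compact K -> is_convex K -> K 0 ->
  polar (polar K) z -> K z.
Proof.
move=> cK xK K0 Kz.
have [c cK' cmin] : exists2 c, c \in K & forall x, x \in K ->
    dot (c - z) (c - z) <= dot (x - z) (x - z).
  apply: compact_EVT_min => //; first by exists 0.
  apply: continuous_subspaceT.
  have cz : continuous (fun x : 'rV[R]_n => x - z).
    move=> x; exact: (@continuousB _ _ _ id (cst z) x (fun A hA => hA)
      (@cst_continuous _ _ z x)).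
  exact: (dot_continuous cz cz).
have {cK'}Kc : K c by exact: set_mem.
(* [w] is normal to the separating hyperplane: [key] shows that the nearest point [c] maximizes
   [dot _ w] over [K]. *)
have [w wE] : exists w, w = z - c by exists (z - c).
have key x : K x -> dot x w <= dot c w.
  move=> Kx; rewrite -subr_le0 -dotBl.
  have [d dE] : exists d, d = x - c by exists (x - c).
  rewrite -dE.
  (* Moving from [c] towards [x] by the fraction [t] does not come closer to [z]; the squares are
     expanded and divided by [t]. A small [t] then rules out [dot d w > 0]. *)
  have t_le t : 0 < t -> t <= 1 -> dot d w *+ 2 <= t * dot d d.
    move=> t0 t1; have Kt := xK _ _ t Kx Kc (ltW t0) t1.
    have := cmin _ (mem_set Kt).
    have -> : t *: x + (1 - t) *: c - z = t *: d - w.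
      by rewrite dE wE; apply/rowP => i; rewrite !mxE; ring.
    have -> : c - z = - w by rewrite wE opprB.
    rewrite dotNl dotNr opprK dotBl !dotBr !(dotZl, dotZr) (dotC w d).
    by move=> h; rewrite -(ler_pM2l t0); lra.
  rewrite leNgt; apply/negP => d0.
  have dd := dot_ge0 d.
  pose t := Num.min 1 (dot d w / (dot d d + 1)).
  have t0 : 0 < t by rewrite lt_min ltr01 divr_gt0//; lra.
  have := t_le t t0; rewrite ge_min lexx => /(_ isT).
  apply/negP; rewrite -ltNge.
  have : t * (dot d d + 1) <= dot d w.
    by rewrite -ler_pdivlMr ?ge_min ?lexx ?orbT//; lra.
  lra.
have [w0|w0] := eqVneq (dot w w) 0.
  by have := dot_eq0 w0 => /eqP; rewrite wE subr_eq0 => /eqP ->.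
have {}w0 : 0 < dot w w by rewrite lt_neqAle eq_sym w0 dot_ge0.
have m0 : 0 <= dot c w by have := key 0 K0; rewrite dot0l.
(* This level lies strictly between the maximum [dot c w] over [K] and the value [dot c w + dot w w]
   at [z]. Half the gap is added so that it is positive and [w] can be normalized by it. *)
have s0 : 0 < dot c w + dot w w / 2 by lra.
have : polar K ((dot c w + dot w w / 2)^-1 *: w).
  move=> x /key xw; rewrite dotZr ler_pdivrMl//; lra.
move=> /Kz; rewrite dotZl ler_pdivrMl// mulr1.
have -> : z = w + c by rewrite wE subrK.
rewrite dotDr (dotC w c); lra.
Qed.

Lemma sym_body0 n (K : set 'rV[R]_n) : sym_body K -> K 0.
Proof. by case=> _ _ /nbhs_singleton. Qed.

Lemma bipolar n (K : set 'rV[R]_n) : sym_body K -> polar (polar K) = K.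
Proof.
move=> sK; have K0 := sym_body0 sK; case: sK => cK xK _ _.
apply/seteqP; split => z; first exact: bipolar_sub.
by move=> Kz y Ky; rewrite dotC; exact: Ky.
Qed.

Lemma convex_hpolar n (K : set 'rV[R]_n) c : is_convex (hpolar K c).
Proof.
move=> x y t Kx Ky t0 t1 a Ka; rewrite dotDr !dotZr.
have := Kx _ Ka; have := Ky _ Ka => h1 h2.
have := ler_wpM2l t0 h2; have : 0 <= 1 - t by lra.
by move=> /ler_wpM2l/(_ _ _ h1); lra.
Qed.

(** A sup-norm ball of radius [r] inside [K] contains the signed multiples [r] of the basis vectors,
    and testing against them bounds each coordinate by [r^-1]. *)
Lemma polar_norm_bound n (K : set 'rV[R]_n) : nbhs (0 : 'rV[R]_n) K ->
  exists2 M, 0 < M & forall y, polar K y -> `|y| <= M.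
Proof.
move=> /nbhs0_normP[r r0 rK]; exists r^-1; first by rewrite invr_gt0.
move=> y Ky; apply: norm_leP; first by rewrite invr_ge0 ltW.
have rx i : `|(r * Num.sg (y 0 i)) *: delta_mx 0 i : 'rV[R]_n| <= r.
  apply: norm_leP => [|j]; first exact: ltW.
  rewrite !mxE !normrM (gtr0_norm r0) normr_sg eqxx /=.
  case: (j == i); case: (y 0 i != 0); rewrite ?normr0 ?normr1 ?mulr1 ?mulr0//=;
  exact: ltW.
move=> i; rewrite -[leRHS]mulr1 ler_pdivlMl//; have := Ky _ (rK _ (rx i)).
by rewrite dotZl dot_delta -mulrA -normrEsg.
Qed.

(** The bound is 1/2 so that two such squares still sum to at most 1, as needed for a neighbourhood
    of 0 in [l2_sum]; [n.+1] keeps the denominator nonzero in dimension 0. *)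
Lemma norm_bound_polar n (K : set 'rV[R]_n) M : 0 < M ->
  (forall x, K x -> `|x| <= M) ->
  exists2 r, 0 < r & forall x y, K x -> `|y| <= r -> `|dot x y| <= 2^-1.
Proof.
move=> M0 KM; have d0 : 0 < 2 * (n.+1%:R * M) by rewrite !mulr_gt0.
exists (2 * (n.+1%:R * M))^-1; first by rewrite invr_gt0.
move=> x y Kx yr; apply: le_trans (dot_norm_le _ _) _.
have nM : n%:R * (`|x| * `|y|) <= n.+1%:R * (M * (2 * (n.+1%:R * M))^-1).
  by rewrite !ler_pM ?mulr_ge0// ?ler_nat// KM.
apply: le_trans nM _; rewrite le_eqVlt; apply/orP; left; apply/eqP.
by field; rewrite gt_eqF //= pnatr_eq0.
Qed.

Lemma sym_body_polar n (K : set 'rV[R]_n) : sym_body K -> sym_body (polar K).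
Proof.
move=> [cK xK K0 sK]; split.
- have [M M0 KM] := polar_norm_bound K0.
  by apply: closed_bounded_compact KM; exact: closed_polar.
- exact: convex_hpolar.
- have [M M0 KM] := compact_norm_bound cK.
  have [r r0 rP] := norm_bound_polar M0 KM.
  apply/nbhs0_normP; exists r => // y yr x Kx.
  by have := rP _ _ Kx yr; rewrite ler_norml => /andP[_]; lra.
- by move=> y Ky x Kx; rewrite dotNr -dotNl; apply: Ky; exact: sK.
Qed.

Lemma lsubmx_norm_le a b (x : 'rV[R]_(a + b)) : `|lsubmx x| <= `|x|.
Proof. by apply: norm_leP => // i; rewrite mxE coord_le_norm. Qed.

Lemma rsubmx_norm_le a b (x : 'rV[R]_(a + b)) : `|rsubmx x| <= `|x|.
Proof. by apply: norm_leP => // i; rewrite mxE coord_le_norm. Qed.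

Lemma hsubmx_norm_le a b (x : 'rV[R]_(a + b)) M :
  `|lsubmx x| <= M -> `|rsubmx x| <= M -> `|x| <= M.
Proof.
move=> lM rM; apply: norm_leP; first exact: le_trans lM.
move=> i; rewrite -(hsubmxK x) mxE; case: splitP => j _.
- exact: le_trans (coord_le_norm _ _) lM.
- exact: le_trans (coord_le_norm _ _) rM.
Qed.

Lemma lsubmx_continuous a b : continuous (@lsubmx R 1 a b).
Proof.
move=> x A /nbhs_ballP[e /= e0 eA]; apply/nbhs_ballP; exists e => // y.
rewrite mx_norm_ball /ball_ /= => xy; apply: eA.
rewrite mx_norm_ball /ball_ /= -linearB /=; exact: le_lt_trans (lsubmx_norm_le _) xy.
Qed.

Lemma rsubmx_continuous a b : continuous (@rsubmx R 1 a b).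
Proof.
move=> x A /nbhs_ballP[e /= e0 eA]; apply/nbhs_ballP; exists e => // y.
rewrite mx_norm_ball /ball_ /= => xy; apply: eA.
rewrite mx_norm_ball /ball_ /= -linearB /=; exact: le_lt_trans (rsubmx_norm_le _) xy.
Qed.

Lemma compact_closed_row n (K : set 'rV[R]_n) : compact K -> closed K.
Proof. by apply: compact_closed; exact: norm_hausdorff. Qed.

Lemma sym_body_prod a b (A : set 'rV[R]_a) (B : set 'rV[R]_b) :
  sym_body A -> sym_body B -> sym_body (prod_set A B).
Proof.
move=> [cA xA A0 sA] [cB xB B0 sB]; split.
- have [M M0 AM] := compact_norm_bound cA.
  have [N N0 BN] := compact_norm_bound cB.
  apply: (@closed_bounded_compact _ _ _ (Num.max M N)).
    apply: closedI.
    + have /continuous_closedP h := @lsubmx_continuous a b.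
      exact: h (compact_closed_row cA).
    + have /continuous_closedP h := @rsubmx_continuous a b.
      exact: h (compact_closed_row cB).
  move=> x [/AM Ax /BN Bx].
  by apply: hsubmx_norm_le; rewrite le_max ?Ax ?Bx ?orbT.
- move=> x y t [Ax Bx] [Ay By] t0 t1.
  by split; rewrite linearD !linearZ; [exact: xA|exact: xB].
- move: A0 B0 => /nbhs0_normP[r r0 rA] /nbhs0_normP[s s0 sB'].
  apply/nbhs0_normP; exists (Num.min r s); first by rewrite lt_min r0.
  move=> x; rewrite le_min => /andP[xr xs]; split.
  + by apply: rA; exact: le_trans (lsubmx_norm_le _) xr.
  + by apply: sB'; exact: le_trans (rsubmx_norm_le _) xs.
- by move=> x [Ax Bx]; split; rewrite linearN; [exact: sA|exact: sB].
Qed.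

Lemma sym_body_pt : sym_body [set: 'rV[R]_0].
Proof.
split => //; last exact: filterT.
apply: (@closed_bounded_compact _ _ _ 0); first exact: closedT.
by move=> x _; apply: norm_leP => // -[].
Qed.

End sym_body.

(** * The self-polar body of a symmetric body *)

Section l2_sum.
Context {R : realType}.

(* The unit ball of the l2-sum of the norms of [K] and [polar K], whose duals
   are the support functions of [polar K] and [K]. *)
Definition l2_sum n (K : set 'rV[R]_n) : set 'rV[R]_(n + n) :=
  [set x | forall ab : 'rV[R]_n * 'rV[R]_n, K ab.1 /\ polar K ab.2 ->
     dot ab.1 (rsubmx x) ^+ 2 + dot ab.2 (lsubmx x) ^+ 2 <= 1].

Lemma omegaE n (x y : 'rV[R]_(n + n)) :
  omega x y = dot (lsubmx x) (rsubmx y) - dot (rsubmx x) (lsubmx y).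
Proof.
rewrite /omega /dot -sumrB; apply: eq_bigr => i _.
by rewrite /coord_q /coord_p !mxE.
Qed.

Lemma closed_l2_sum n (K : set 'rV[R]_n) : closed (l2_sum K).
Proof.
apply: (@closed_le_family _ _ _ _ (fun ab x =>
  dot ab.1 (rsubmx x) ^+ 2 + dot ab.2 (lsubmx x) ^+ 2)) => -[a b] _ x /=.
have cr : {for x, continuous (fun x : 'rV[R]_(n + n) => dot a (rsubmx x))}.
  exact: (continuous_comp (@rsubmx_continuous _ _ _ x) (@dot_continuousr _ _ _ _)).
have cl : {for x, continuous (fun x : 'rV[R]_(n + n) => dot b (lsubmx x))}.
  exact: (continuous_comp (@lsubmx_continuous _ _ _ x) (@dot_continuousr _ _ _ _)).
exact: (continuousD (continuousM cr cr) (continuousM cl cl)).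
Qed.

Lemma sqr_le1 (x : R) : x ^+ 2 <= 1 -> x <= 1.
Proof. by move=> x1; rewrite leNgt; apply/negP => ?; move: x1; nra. Qed.

Lemma l2_sum_sub n (K : set 'rV[R]_n) x : sym_body K -> l2_sum K x ->
  K (lsubmx x) /\ polar K (rsubmx x).
Proof.
move=> sK Xx; split.
- rewrite -(bipolar sK) => b Kb; apply: sqr_le1.
  by have := Xx (0, b) (conj (sym_body0 sK) Kb); rewrite /= dot0l expr0n add0r.
- move=> a Ka; apply: sqr_le1.
  have := Xx (a, 0) (conj Ka (sym_body0 (sym_body_polar sK))).
  by rewrite /= dot0l expr0n addr0.
Qed.

Lemma sym_body_l2_sum n (K : set 'rV[R]_n) : sym_body K -> sym_body (l2_sum K).
Proof.
move=> sK; have sK' := sym_body_polar sK; split.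
- have [M M0 KM] : exists2 M, 0 < M & forall x, K x -> `|x| <= M.
    by apply: compact_norm_bound; case: sK.
  have [M' M0' KM'] : exists2 M, 0 < M & forall x, polar K x -> `|x| <= M.
    by apply: compact_norm_bound; case: sK'.
  apply: (@closed_bounded_compact _ _ _ (Num.max M M')).
    exact: closed_l2_sum.
  move=> x /(l2_sum_sub sK)[/KM xM /KM' xM'].
  by apply: hsubmx_norm_le; rewrite le_max ?xM ?xM' ?orbT.
- move=> x y t Xx Xy t0 t1 ab Kab.
  have := Xx ab Kab; have := Xy ab Kab; rewrite !linearD !linearZ /= !dotDr !dotZr.
  move: (dot _ _) (dot _ _) (dot _ _) (dot _ _) => u v w z h1 h2.
  (* [t * (1 - t)] times a squared difference is exactly the defect in the convexity inequality for
     the square. *)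
  have t2 : 0 <= t * (1 - t) by rewrite mulr_ge0//; lra.
  have := mulr_ge0 t2 (sqr_ge0 (u - w)); have := mulr_ge0 t2 (sqr_ge0 (v - z)).
  have := ler_wpM2l t0 h2; have : 0 <= 1 - t by lra.
  by move=> /ler_wpM2l/(_ _ _ h1); nra.
- have [M M0 KM] : exists2 M, 0 < M & forall x, K x -> `|x| <= M.
    by apply: compact_norm_bound; case: sK.
  have [M' M0' KM'] : exists2 M, 0 < M & forall x, polar K x -> `|x| <= M.
    by apply: compact_norm_bound; case: sK'.
  have [r r0 rP] := norm_bound_polar M0 KM.
  have [s s0 sP] := norm_bound_polar M0' KM'.
  apply/nbhs0_normP; exists (Num.min r s); first by rewrite lt_min r0.
  move=> x; rewrite le_min => /andP[xr xs] [a b] /= [Ka Kb].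
  have := rP _ _ Ka (le_trans (rsubmx_norm_le x) xr).
  have := sP _ _ Kb (le_trans (lsubmx_norm_le x) xs).
  by rewrite !ler_norml => /andP[h1 h2] /andP[h3 h4]; nra.
- by move=> x Xx ab Kab; rewrite !linearN !dotNr !sqrrN; exact: Xx.
Qed.

(** The duality inequality between a norm and its dual: dividing [q] by its bound puts it in [K], by
    the bipolar theorem. When [s = 0], arbitrarily small positive bounds are used instead. *)
Lemma dot_le_polar_bounds n (K : set 'rV[R]_n) q p s t : sym_body K ->
  0 <= s -> 0 <= t -> (forall b, polar K b -> dot b q <= s) ->
  (forall a, K a -> dot a p <= t) -> dot q p <= s * t.
Proof.
move=> sK s0 t0 qs pt.
have bound e : 0 < e -> s <= e -> dot q p <= e * t.
  move=> e0 se; have : K (e^-1 *: q).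
    rewrite -(bipolar sK) => b Kb; rewrite dotZr ler_pdivrMl// mulr1.
    exact: le_trans (qs b Kb) se.
  by move=> /pt; rewrite dotZl ler_pdivrMl.
move: s0; rewrite le_eqVlt => /orP[/eqP s0|s0]; last exact: bound.
rewrite -s0 mul0r leNgt; apply/negP => d0.
have t1 : 0 < 2 * (t + 1) by lra.
have e0 : 0 < dot q p / (2 * (t + 1)) by rewrite divr_gt0.
have := bound _ e0; rewrite -s0 (ltW e0) => /(_ isT).
by rewrite mulrAC ler_pdivlMr//; nra.
Qed.

Lemma symplectic_polar_l2_sum n (K : set 'rV[R]_n) : sym_body K ->
  symplectic_polar (l2_sum K) = l2_sum K.
Proof.
move=> sK; have sK' := sym_body_polar sK; apply/seteqP; split => y.
- move=> Xy [a b] /= [Ka Kb]; rewrite leNgt; apply/negP => y1.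
  set u := dot a _ in y1 *; set v := dot b _ in y1 *.
  pose r := Num.sqrt (u ^+ 2 + v ^+ 2).
  have rr : r * r = u ^+ 2 + v ^+ 2 by rewrite -expr2 sqr_sqrtr// addr_ge0 ?sqr_ge0.
  have r1 : 1 < r by rewrite -sqrtr1 ltr_sqrt//; lra.
  have r0 : 0 < r by lra.
  (* This point pairs with [y] to exactly [r]. It lies in [l2_sum K] because [dot c b] and [dot d a]
     have absolute value at most 1 and the coefficients [u / r], [v / r] have squares summing to
     1. *)
  have := Xy (row_mx ((u / r) *: a) (- (v / r) *: b)).
  rewrite omegaE row_mxKl row_mxKr !dotZl -/u -/v.
  have -> : u / r * u - - (v / r) * v = r by field: rr; rewrite gt_eqF.
  move=> h; have /h : l2_sum K (row_mx ((u / r) *: a) (- (v / r) *: b)).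
    move=> [c d] /= [Kc Kd]; rewrite row_mxKl row_mxKr !dotZr.
    have c1 : dot c b ^+ 2 <= 1.
      have := Kb _ Kc; have := Kb (- c); rewrite dotNl.
      have : K (- c) by case: sK => _ _ _; exact.
      by move=> Kc' /(_ Kc'); nra.
    have d1 : dot d a ^+ 2 <= 1.
      have := Kd _ Ka; have := Kd (- a); rewrite dotNl (dotC d).
      have : K (- a) by case: sK => _ _ _; exact.
      by move=> Ka' /(_ Ka'); nra.
    rewrite !exprMn sqrrN !exprMn exprVn.
    have -> : v ^+ 2 * r ^- 2 * dot c b ^+ 2 + u ^+ 2 * r ^- 2 * dot d a ^+ 2 =
      (v ^+ 2 * dot c b ^+ 2 + u ^+ 2 * dot d a ^+ 2) / r ^+ 2 by ring.
    rewrite ler_pdivrMr ?exprn_gt0// mul1r [r ^+ 2]expr2 rr.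
    have := ler_wpM2l (sqr_ge0 v) c1; have := ler_wpM2l (sqr_ge0 u) d1; lra.
  lra.
- move=> Xy x Xx; rewrite omegaE.
  (* By compactness the support functions are attained, so a single test pair in the definition of
     [l2_sum] bounds the sum of the two squared norms. *)
  have maxE (L : set 'rV[R]_n) z : sym_body L ->
      exists2 a, L a & 0 <= dot a z /\ forall c, L c -> dot c z <= dot a z.
    move=> sL; have [a La amax] : exists2 a, a \in L & forall c, c \in L ->
        dot c z <= dot a z.
      apply: compact_EVT_max; first by exists 0; exact: sym_body0.
        by case: sL.
      by apply: continuous_subspaceT; exact: dot_continuousl.
    exists a; first exact: set_mem.
    split=> [|c Lc]; last by apply: amax; exact: mem_set.
    by rewrite -(dot0l z); apply: amax; apply: mem_set; exact: sym_body0.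
  have [a Ka [a0 aP]] := maxE K (rsubmx x) sK.
  have [b Kb [b0 bP]] := maxE (polar K) (lsubmx x) sK'.
  have [c Kc [c0 cP]] := maxE K (rsubmx y) sK.
  have [d Kd [d0 dP]] := maxE (polar K) (lsubmx y) sK'.
  have := Xx (a, b) (conj Ka Kb); have := Xy (c, d) (conj Kc Kd) => /=.
  have := dot_le_polar_bounds sK b0 c0 bP cP.
  have NyP e : K e -> dot e (- rsubmx x) <= dot a (rsubmx x).
    move=> Ke; rewrite dotNr -dotNl; apply: aP.
    by case: sK => _ _ _; exact.
  have := dot_le_polar_bounds sK d0 a0 dP NyP.
  rewrite dotNr (dotC (lsubmx y)).
  move: (dot a _) (dot b _) (dot c _) (dot d _) => u v w z h1 h2 h3 h4.
  (* The two products are at most half the sum of all four squares, which is at most 1. *)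
  by have := sqr_ge0 (u - z); have := sqr_ge0 (v - w); lra.
Qed.

Lemma self_polar_l2_sum n (K : set 'rV[R]_n) : sym_body K ->
  self_polar_body (l2_sum K).
Proof.
move=> sK; have [cX xX X0 sX] := sym_body_l2_sum sK; split => //.
- by split => //; [exact/is_convexP|exists 0].
- exact: symplectic_polar_l2_sum.
Qed.

End l2_sum.

(** * Volume bounds *)

(** Compares coefficients of [X^N] in the product of the series [(1 - X)^-(a+1)] and
    [(1 - X)^-(b+1)]; the proof is a double induction with Pascal's rule. *)
Lemma sum_bin_conv a b N :
  (\sum_(i < N.+1) 'C(i + a, a) * 'C(N - i + b, b) = 'C(N + (a + b).+1, (a + b).+1))%N.
Proof.
elim: a N => [|a IHa] N.
  under eq_bigr do rewrite bin0 mul1n.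
  elim: N => [|N IHN]; first by rewrite big_ord1 !add0n !binn.
  rewrite big_ord_recl /= subn0.
  under eq_bigr do rewrite /bump /= add1n subSS.
  by rewrite IHN add0n [in RHS]addSn binS addnC -addSnnS.
elim: N => [|N IHN]; first by rewrite big_ord1 /= ?subn0 !add0n !binn.
have -> : (N.+1 + (a.+1 + b).+1 = (N.+1 + (a + b).+1).+1)%N by rewrite addnS.
rewrite [X in 'C(_, X.+1)]addSn binS -IHa.
have -> : (N.+1 + (a + b).+1 = N + (a.+1 + b).+1)%N by rewrite addSnnS addSn.
rewrite -IHN big_ord_recl [X in (_ = _ + X)%N]big_ord_recl !subn0 /=.
have -> : (\sum_(i < N.+1) 'C(bump 0 i + a.+1, a.+1) * 'C(N.+1 - bump 0 i + b, b) =
  \sum_(i < N.+1) ('C(i + a.+1, a.+1) * 'C(N - i + b, b)) +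
  \sum_(i < N.+1) ('C(bump 0 i + a, a) * 'C(N.+1 - bump 0 i + b, b)))%N.
  rewrite -big_split; apply: eq_bigr => i _ /=.
  by rewrite /bump /= !add1n subSS addSn binS mulnDl addSnnS.
by rewrite !add0n !binn !mul1n addnCA.
Qed.

Lemma expn_le_ffact k j : (j.+1 ^ k <= (j + k) ^_ k)%N.
Proof.
elim: k => [|k IH]; first by rewrite expn0 ffactn0.
rewrite addnS ffactSS expnS leq_mul//.
by rewrite ltnS leq_addr.
Qed.

Lemma ffact_le_expn k n : (n ^_ k <= n ^ k)%N.
Proof.
elim: k n => [|k IH] [|n]; rewrite ?ffactn0 ?ffact0n// ffactSS expnS leq_mul//.
by apply: leq_trans (IH n) _; case: (k) => // j; rewrite leq_exp2r.
Qed.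

(** Mean value bound for the power function on [[i, i + 1]], whose derivative is largest at the
    right end. *)
Lemma expnB_le a i : (i.+1 ^ a.+1 - i ^ a.+1 <= a.+1 * i.+1 ^ a)%N.
Proof.
elim: a => [|a IH]; first by rewrite !expn1 subSn// subnn.
rewrite leq_subLR; move: IH; rewrite leq_subLR => IH.
rewrite [(i.+1 ^ a.+2)%N]expnS [(i ^ a.+2)%N]expnS.
have := leq_mul (leqnn i.+1) IH.
rewrite mulnDr (mulnCA _ a.+1) -[(i.+1 * i.+1 ^ a)%N]expnS.
have : (i ^ a.+1 <= i.+1 ^ a.+1)%N by rewrite leq_exp2r.
move: (i ^ a.+1)%N (i.+1 ^ a.+1)%N => p q; nia.
Qed.

(* Discrete form of [a.+1 * \int_0^1 t^a (1 - t)^b dt = a.+1! b! / (a.+1 + b)!]: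
   the sum is dominated termwise by a convolution of binomial coefficients. *)
Lemma beta_sum_le a b N : ((a.+1 + b)`! *
    \sum_(i < N) (i.+1 ^ a.+1 - i ^ a.+1) * (N - i) ^ b <=
  a.+1`! * b`! * (N + (a.+1 + b)) ^ (a.+1 + b))%N.
Proof.
apply: (@leq_trans ((a.+1 + b)`! *
    (a.+1`! * b`! * 'C(N + (a + b).+1, (a + b).+1)))%N).
  rewrite leq_mul2l; apply/orP; right.
  (* The convolution has [N.+1] terms; the last one, at [i = N], is discarded. *)
  rewrite -sum_bin_conv big_ord_recr /= mulnDr; apply: leq_trans (leq_addr _ _).
  rewrite big_distrr /=; apply: leq_sum => i _.
  rewrite -mulnACA leq_mul//.
    apply: leq_trans (expnB_le _ _) _; rewrite factS -mulnA leq_mul2l/=.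
    rewrite mulnC bin_ffact.
    exact: expn_le_ffact.
  rewrite mulnC bin_ffact; apply: leq_trans (expn_le_ffact _ _).
  by case: (b) => // k; rewrite leq_exp2r.
rewrite addSn mulnCA leq_mul2l [(_ * 'C(_, _))%N]mulnC bin_ffact.
by rewrite ffact_le_expn orbT.
Qed.

(** * Shell estimates for l2-sums and for polars of products *)

Section volume_bounds.
Context {R : realType}.

(* Locates the support function [h] of [L] at [p]: [i / N <= h <= (i + 1) / N]. *)
Lemma polar_shell n (L : set 'rV[R]_n) p N : (0 < N)%N -> polar L p ->
  exists2 i, (i < N)%N & hpolar L (i.+1%:R / N%:R) p /\
    ((0 < i)%N -> ~ hpolar L (i%:R / N%:R) p).
Proof.
move=> N0 Lp; pose P i := `[< hpolar L (i.+1%:R / N%:R) p >].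
have PN : P N.-1.
  by apply/asboolP => x Lx; rewrite prednK// divff ?pnatr_eq0 -?lt0n//; exact: Lp.
have [i /asboolP Pi imin] := ex_minnP (ex_intro P _ PN).
exists i; first by rewrite -(prednK N0) ltnS; exact: imin.
by split=> //; case: i Pi imin => // i _ imin _ /asboolP /imin; rewrite ltnn.
Qed.

(** A point where the upper bound [i / N] fails witnesses the lower bound; in the innermost shell
    the level is 0 and the origin serves. *)
Lemma shell_witness n (L : set 'rV[R]_n) p i N : L 0 ->
  ((0 < i)%N -> ~ hpolar L (i%:R / N%:R) p) ->
  exists2 x, L x & i%:R / N%:R <= dot x p.
Proof.
case: i => [|i] L0 Lp; first by exists 0; rewrite // mul0r dot0l.
have /existsNP[x /not_implyP[Lx /negP]] := Lp isT.
by rewrite -ltNge => /ltW; exists x.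
Qed.

Lemma vol_l2_sum_le n (K : set 'rV[R]_n) N : sym_body K -> (0 < N)%N ->
  (vol (l2_sum K) <=
    (N%:R * (2^-1 + N%:R^-1) ^+ n)%:E * (vol K * vol (polar K)))%E.
Proof.
move=> sK N0; have sK' := sym_body_polar sK.
have N0' : 0 < N%:R :> R by rewrite ltr0n.
(* If the norm of [q] is at least [i / N], then the dual norm of [p] is at most [s i]. The pieces
   [F i] keep the whole ball for [q] instead of the shell, which costs only the factor [N]. *)
pose s i : R := Num.sqrt (1 - (i%:R / N%:R) ^+ 2).
pose F i := prod_set (hpolar (polar K) (i.+1%:R / N%:R)) (hpolar K (s i)).
have mF i : borel (F i) by apply: borel_prod; exact: borel_hpolar.
have lt1 i : (i < N)%N -> i%:R / N%:R < 1 :> R.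
  by move=> iN; rewrite ltr_pdivrMr// mul1r ltr_nat.
have ge0 i : 0 <= i%:R / N%:R :> R by rewrite divr_ge0.
have cover : forall x, l2_sum K x -> exists2 i, (i < N)%N & F i x.
  move=> x Xx; have [Kx _] := l2_sum_sub sK Xx.
  have [i iN [Fi Fi']] : exists2 i, (i < N)%N &
      hpolar (polar K) (i.+1%:R / N%:R) (lsubmx x) /\
      ((0 < i)%N -> ~ hpolar (polar K) (i%:R / N%:R) (lsubmx x)).
    by apply: polar_shell => //; rewrite bipolar.
  have [b Kb bx] := shell_witness (sym_body0 sK') Fi'.
  exists i => //; split => // a Ka.
  have := Xx (a, b) (conj Ka Kb) => /= h.
  apply: le_trans (ler_norm _) _; rewrite -sqrtr_sqr ler_sqrt.
    by have := ge0 i; nra.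
  by have := ge0 i; have := lt1 i iN; nra.
apply: le_trans (vol_bigcup_le _ mF cover) _.
  by apply: borel_closed; exact: closed_l2_sum.
apply: (@le_trans _ _ (\sum_(i < N) ((2^-1 + N%:R^-1) ^+ n)%:E *
    (vol K * vol (polar K)))%E); last first.
  rewrite -ge0_sume_distrl; last first.
    by move=> i _; rewrite lee_fin exprn_ge0// addr_ge0.
  by rewrite sumEFin sumr_const card_ord mulr_natl.
apply: lee_sum => i _.
rewrite vol_prod; try exact: borel_hpolar.
have s2 : (s i) ^+ 2 = 1 - (i%:R / N%:R) ^+ 2.
  by rewrite sqr_sqrtr//; have := ge0 i; have := lt1 i (ltn_ord i); nra.
have s0 : 0 < s i.
  by rewrite sqrtr_gt0; have := ge0 i; have := lt1 i (ltn_ord i); nra.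
have i0 : 0 < i.+1%:R / N%:R :> R by rewrite divr_gt0.
rewrite (vol_hpolar _ i0) (vol_hpolar _ s0) bipolar//.
rewrite muleACA -EFinM -exprMn; apply: lee_wpmul2r.
  by apply: mule_ge0; exact: vol_ge0.
rewrite lee_fin; apply: lerXn2r; rewrite ?nnegrE.
- by rewrite mulr_ge0 ?(ltW i0) ?(ltW s0).
- by rewrite addr_ge0.
(* With [t = i / N] and [r = s i], the product [(t + 1/N) * r] is at most [1/2 + 1/N], since
   [2 t r <= t^2 + r^2 = 1] and [r <= 1]. *)
have -> : i.+1%:R / N%:R = i%:R / N%:R + N%:R^-1 :> R.
  by rewrite -natr1 mulrDl mul1r.
have := ge0 i; have : 0 < N%:R^-1 :> R by rewrite invr_gt0.
move: s2 s0; move: (N%:R^-1) (i%:R / N%:R) (s i) => e t r s2 s0 e0 t0.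
have r1 : r <= 1 by nra.
have := sqr_ge0 (t - r); have := ler_wpM2l (ltW e0) r1. lra.
Qed.

Lemma dot_hsubmx a b (c : 'rV[R]_a) (d : 'rV[R]_b) x :
  dot (row_mx c d) x = dot c (lsubmx x) + dot d (rsubmx x).
Proof.
rewrite /dot big_split_ord /=; congr (_ + _); apply: eq_bigr => i _.
  by rewrite row_mxEl mxE.
by rewrite row_mxEr mxE.
Qed.

(** On the polar of a product the two support functions sum to at most 1, so where the first is at
    least [i / N] the second is at most [(N - i) / N]. Genuine shells are needed here, since the
    resulting sum must converge to the sharp constant. *)
Lemma vol_polar_prod_le_shells a b (A : set 'rV[R]_a.+1) (B : set 'rV[R]_b) N :
  sym_body A -> sym_body B -> (0 < N)%N ->
  (vol (polar (prod_set A B)) <=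
    \sum_(i < N) (((i.+1%:R ^+ a.+1 - i%:R ^+ a.+1) * (N - i)%:R ^+ b) /
       N%:R ^+ (a.+1 + b))%:E * (vol (polar A) * vol (polar B)))%E.
Proof.
move=> sA sB N0.
have N0' : 0 < N%:R :> R by rewrite ltr0n.
(* Nothing is removed at [i = 0], so every level is positive as [vol_hpolar] requires; the formula
   still fits because [0 ^+ a.+1 = 0]. *)
pose S i := hpolar A (i.+1%:R / N%:R) `\`
  (if i is 0%N then set0 else hpolar A (i%:R / N%:R)).
pose F i := prod_set (S i) (hpolar B ((N - i)%:R / N%:R)).
have mS i : borel (S i).
  apply: borelD; first exact: borel_hpolar.
  by case: i => [|i]; [exact: measurable0|exact: borel_hpolar].
have mF i : borel (F i) by apply: borel_prod => //; exact: borel_hpolar.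
have cover : forall x, polar (prod_set A B) x -> exists2 i, (i < N)%N & F i x.
  move=> x Px.
  have Ax : polar A (lsubmx x).
    move=> c Ac; have := Px (row_mx c 0); rewrite dot_hsubmx dot0l addr0; apply.
    by split; rewrite ?row_mxKl ?row_mxKr//; exact: sym_body0.
  have [i iN [Fi Fi']] := polar_shell N0 Ax.
  have [c Ac cx] := shell_witness (sym_body0 sA) Fi'.
  exists i => //; split; first by split=> //; case: (i) Fi' => // j; apply.
  move=> d Bd; have := Px (row_mx c d); rewrite dot_hsubmx (natrB _ (ltnW iN)).
  rewrite mulrBl (divff (lt0r_neq0 N0')) => h.
  have /h : prod_set A B (row_mx c d) by split; rewrite ?row_mxKl ?row_mxKr.
  lra.
have volS i : vol (S i) =
    (((i.+1%:R ^+ a.+1 - i%:R ^+ a.+1) / N%:R ^+ a.+1)%:E * vol (polar A))%E.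
  have Afin : vol (polar A) \is a fin_num.
    rewrite ge0_fin_numE ?vol_ge0//; apply: compact_vol_lty.
    by case: (sym_body_polar sA).
  have gt0 j : 0 < j.+1%:R / N%:R :> R by rewrite divr_gt0.
  case: i => [|i].
    rewrite /S setD0 (vol_hpolar _ (gt0 _)); congr (_%:E * _)%E.
    by rewrite expr_div_n expr0n subr0.
  rewrite volD; try exact: borel_hpolar; last 2 first.
  - move=> y Ay x Ax; apply: le_trans (Ay x Ax) _.
    by rewrite ler_pM2r ?invr_gt0// ler_nat.
  - by rewrite (vol_hpolar _ (gt0 i)) -(fineK Afin) -EFinM ltry.
  rewrite (vol_hpolar _ (gt0 i)) (vol_hpolar _ (gt0 i.+1)) -(fineK Afin).
  rewrite -!EFinM -EFinB; congr _%:E.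
  by rewrite !expr_div_n; ring.
apply: le_trans (vol_bigcup_le _ mF cover) _; first exact: borel_hpolar.
apply: lee_sum => i _; rewrite vol_prod//; last exact: borel_hpolar.
have Ni : 0 < (N - i)%:R / N%:R :> R by rewrite divr_gt0// ltr0n subn_gt0.
rewrite volS (vol_hpolar _ Ni).
rewrite muleACA -EFinM le_eqVlt; apply/orP; left; apply/eqP; congr (_%:E * _)%E.
by rewrite expr_div_n exprD invfM; ring.
Qed.

Lemma le_horner0 (p : {poly R}) v :
  (forall N : nat, v <= p.[N.+1%:R^-1]) -> v <= p.[0].
Proof.
move=> vp.
have cp : (horner p \o @harmonic R) @ \oo --> p.[0].
  exact: (cvg_comp (@harmonic R) _ cvg_harmonic (@continuous_horner R p 0)).
by apply: (cvgr_to_ge cp); near=> N; exact: vp.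
Unshelve. all: by end_near.
Qed.

Lemma vol_polar_prod_le a b (A : set 'rV[R]_a.+1) (B : set 'rV[R]_b) :
  sym_body A -> sym_body B ->
  (vol (polar (prod_set A B)) <=
    (a.+1`!%:R * b`!%:R / (a.+1 + b)`!%:R)%:E * (vol (polar A) * vol (polar B)))%E.
Proof.
move=> sA sB.
have fin m (L : set 'rV[R]_m) : sym_body L -> vol (polar L) \is a fin_num.
  move=> sL; rewrite ge0_fin_numE ?vol_ge0//; apply: compact_vol_lty.
  by case: (sym_body_polar sL).
have vge0 m (L : set 'rV[R]_m) : 0 <= fine (vol (polar L)).
  by apply: fine_ge0; exact: vol_ge0.
have := vge0 _ A; have := vge0 _ B.
have shells := fun N : nat => vol_polar_prod_le_shells sA sB (ltn0Sn N).
move: shells; rewrite -(fineK (fin _ _ sA)) -(fineK (fin _ _ sB)).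
rewrite -(fineK (fin _ _ (sym_body_prod sA sB))) -!EFinM lee_fin.
move: (fine (vol (polar A))) (fine (vol (polar B))) => x y.
move: (fine _) => v shells y0 x0.
set k := (a.+1 + b)%N; set C := a.+1`!%:R * b`!%:R / k`!%:R.
(* At [1 / N] this is the shell bound after [beta_sum_le], as [(N + k)^k / N^k = (1 + k / N)^k]; its
   value at 0 is the sharp bound. *)
pose p : {poly R} := (C * (x * y)) *: (1 + k%:R *: 'X) ^+ k.
have -> : C * (x * y) = p.[0].
  by rewrite !(hornerE, horner_exp) ?mulr0 ?addr0 expr1n ?mulr1.
apply: le_horner0 => N.
have -> : p.[N.+1%:R^-1] = C * (1 + k%:R * N.+1%:R^-1) ^+ k * (x * y).
  rewrite hornerZ horner_exp hornerD hornerC hornerZ hornerX. by rewrite mulrAC.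
have := shells N; rewrite -ge0_sume_distrl//; last first.
  move=> i _; rewrite lee_fin divr_ge0 ?exprn_ge0// mulr_ge0 ?exprn_ge0//.
  by rewrite subr_ge0 lerXn2r ?nnegrE// ler_nat.
rewrite sumEFin -EFinM lee_fin => /le_trans; apply.
rewrite ler_wpM2r ?mulr_ge0//.
rewrite -mulr_suml ler_pdivrMr ?exprn_gt0//.
have -> : C * (1 + k%:R * N.+1%:R^-1) ^+ k * N.+1%:R ^+ k =
    C * (N.+1 + k)%:R ^+ k :> R.
  rewrite -mulrA -exprMn; congr (_ * _ ^+ k).
  by rewrite mulrDl mul1r mulfVK ?pnatr_eq0// natrD.
rewrite mulrAC ler_pdivlMr ?ltr0n ?fact_gt0//.
have := beta_sum_le a b N.+1; rewrite -/k.
move: (k`!)%N (a.+1`!)%N (b`!)%N => u v' w'.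
rewrite -(ler_nat R) !natrM natrX natr_sum mulrC; apply: le_trans.
apply: ler_wpM2r => //; apply: ler_sum => i _.
have ia : (i ^ a.+1 <= i.+1 ^ a.+1)%N by rewrite leq_exp2r.
by rewrite natrM (natrB _ ia) !natrX.
Qed.

End volume_bounds.

(** * Mahler's inequality *)

Section Mahler.
Context {R : realType}.

(* [m'.+1 * n] reduces to [n + m' * n]. *)
Fixpoint cart_pow n (K : set 'rV[R]_n) m : set 'rV[R]_(m * n) :=
  match m return set 'rV[R]_(m * n) with
  | 0 => setT
  | m'.+1 => prod_set K (@cart_pow n K m')
  end.
Arguments cart_pow {n} K m.

Lemma sym_body_cart_pow n (K : set 'rV[R]_n) m :
  sym_body K -> sym_body (cart_pow K m).
Proof.
move=> sK; elim: m => [|m IH]; first exact: sym_body_pt.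
exact: sym_body_prod.
Qed.

Lemma sym_body_borel n (K : set 'rV[R]_n) : sym_body K -> borel K.
Proof. by case=> cK _ _ _; exact: compact_borel. Qed.

Lemma sym_body_vol n (K : set 'rV[R]_n) : sym_body K ->
  vol K = (fine (vol K))%:E.
Proof.
case=> cK _ _ _; rewrite fineK// ge0_fin_numE ?vol_ge0//.
exact: compact_vol_lty.
Qed.

Lemma vol_rV0 (K : set 'rV[R]_0) : sym_body K -> vol K = 1%E.
Proof.
move=> /sym_body0 K0; rewrite /vol /= diracE mem_set//=.
by rewrite (_ : row_of_tuple _ = 0)//; apply/rowP => -[].
Qed.

Lemma vol_cart_pow n (K : set 'rV[R]_n) m : sym_body K ->
  vol (cart_pow K m) = (fine (vol K) ^+ m)%:E.
Proof.
move=> sK; elim: m => [|m IH]; first exact: (vol_rV0 sym_body_pt).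
have sKm := sym_body_cart_pow m sK.
rewrite exprS EFinM -IH -sym_body_vol//.
by apply: vol_prod; exact: sym_body_borel.
Qed.

(** The factorial quotients of [vol_polar_prod_le] telescope along the induction on [m]. *)
Lemma vol_polar_cart_pow_le n (K : set 'rV[R]_n.+1) m : sym_body K ->
  (vol (polar (cart_pow K m)) <=
    ((fine (vol (polar K)) * n.+1`!%:R) ^+ m / (m * n.+1)`!%:R)%:E)%E.
Proof.
move=> sK; elim: m => [|m IH].
  rewrite (vol_rV0 (sym_body_polar sym_body_pt)).
  by rewrite expr0 mul0n fact0 divr1.
have sKm := sym_body_cart_pow m sK.
apply: le_trans (vol_polar_prod_le sK sKm) _.
apply: (@le_trans _ _ ((n.+1`!%:R * (m * n.+1)`!%:R / (n.+1 + m * n.+1)`!%:R)%:E *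
  (vol (polar K) * ((fine (vol (polar K)) * n.+1`!%:R) ^+ m /
    (m * n.+1)`!%:R)%:E))%E).
  apply: lee_wpmul2l; first by rewrite lee_fin divr_ge0// mulr_ge0.
  by apply: lee_wpmul2l IH; exact: vol_ge0.
rewrite {1}(sym_body_vol (sym_body_polar sK)) -!EFinM lee_fin mulSn exprS.
have u0 := fact_gt0 (n.+1 + m * n.+1); have z0 := fact_gt0 (m * n.+1).
move: (fine _) u0 z0; rewrite !lt0n -!(eqr_nat R).
move: ((_ + _)`!)%N (n.+1`!)%N ((m * n.+1)`!)%N => u w z y u0 z0.
by rewrite le_eqVlt; apply/orP; left; apply/eqP; field; rewrite u0 z0.
Qed.

Lemma self_polar_bound_cart_pow n (K : set 'rV[R]_n.+1) c m N : sym_body K ->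
  (forall d (X : set 'rV[R]_(d + d)), (0 < d)%N -> self_polar_body X ->
     ((c d * (2 ^+ d / d`!%:R))%:E <= vol X)%E) ->
  c (m.+1 * n.+1)%N * (4 ^+ n.+1) ^+ m.+1 <=
  N.+1%:R * ((1 + 2 / N.+1%:R) ^+ n.+1 *
    (fine (vol K) * (fine (vol (polar K)) * n.+1`!%:R))) ^+ m.+1.
Proof.
move=> sK cP; have sKm := sym_body_cart_pow m.+1 sK.
have := cP (m.+1 * n.+1)%N _ isT (self_polar_l2_sum sKm).
move=> /le_trans/(_ (vol_l2_sum_le sKm (ltn0Sn N))).
rewrite vol_cart_pow// => /le_trans h.
have {}h := h _ (lee_wpmul2l _ (lee_wpmul2l _ (vol_polar_cart_pow_le m.+1 sK))).
move: h; rewrite -!EFinM !lee_fin => /(_ _ _).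
set d := (m.+1 * n.+1)%N; set v := fine (vol K).
set w := fine (vol (polar K)) * _ => h.
have v0 : 0 <= v by apply: fine_ge0; exact: vol_ge0.
have {}h : c d * (2 ^+ d / d`!%:R) <=
    N.+1%:R * (2^-1 + N.+1%:R^-1) ^+ d * (v ^+ m.+1 * (w ^+ m.+1 / d`!%:R)).
  by apply: h; rewrite ?mulr_ge0 ?exprn_ge0 ?addr_ge0.
have d0 : 0 < d`!%:R :> R by rewrite ltr0n fact_gt0.
(* The factor [1 / d!] is common to both sides and cancels. Multiplying by [2 ^+ d] then gives
   [4 ^+ d] on the left and turns [1/2 + 1/N] into [1 + 2/N] on the right. *)
rewrite !mulrA ler_pM2r ?invr_gt0// in h.
have powd (x : R) : (x ^+ n.+1) ^+ m.+1 = x ^+ d by rewrite -exprM mulnC.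
rewrite [(_ * (v * w)) ^+ _]exprMn !powd.
have -> : 4 ^+ d = 2 ^+ d * 2 ^+ d :> R by rewrite -exprMn; congr (_ ^+ _); ring.
have -> : 1 + 2 / N.+1%:R = 2 * (2^-1 + N.+1%:R^-1) :> R by field.
rewrite [(2 * _) ^+ d]exprMn [(v * w) ^+ _]exprMn.
move: (ler_wpM2l (exprn_ge0 d (ler0n R 2)) h).
move: (c d) N.+1%:R (2 ^+ d) ((2^-1 + _) ^+ d) (v ^+ _) (w ^+ _) => *; lra.
Qed.

(** If [B < A ^+ n.+1], some fixed [N] leaves room for both errors [1 + 2/N] and [e = 1 - 1/N]. As
    [c d] is eventually at least [e ^+ d], the hypothesis bounds the powers of a ratio below 1 away
    from 0, which is absurd. *)
Lemma subexponential_le c (A B : R) n : subexponential c -> 0 <= B ->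
  (forall m N : nat, c (m.+1 * n.+1)%N * (A ^+ n.+1) ^+ m.+1 <=
     N.+1%:R * ((1 + 2 / N.+1%:R) ^+ n.+1 * B) ^+ m.+1) ->
  0 <= A -> A ^+ n.+1 <= B.
Proof.
move=> [c0 c1] B0 cAB A0; rewrite leNgt; apply/negP => BA.
(* [p] is negative at 0, hence at some [N.+1^-1]; this selects [N]. *)
pose p : {poly R} := B *: (1 + 2 *: 'X) ^+ n.+1 - (A ^+ n.+1) *: (1 - 'X) ^+ n.+1.
have pE x : p.[x] = B * (1 + 2 * x) ^+ n.+1 - A ^+ n.+1 * (1 - x) ^+ n.+1.
  by rewrite !(hornerD, hornerN, hornerZ, horner_exp, hornerC, hornerX).
have [N pN] : exists N : nat, p.[N.+1%:R^-1] < 0.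
  apply: contrapT => /forallNP H.
  suff : 0 <= p.[0] by rewrite pE mulr0 addr0 subr0 !expr1n !mulr1; lra.
  by apply: le_horner0 => N; rewrite leNgt; apply/negP; exact: H.
pose e : R := 1 - N.+1%:R^-1.
pose th : R := (1 + 2 / N.+1%:R) ^+ n.+1 * B.
have e0 : 0 <= e by rewrite subr_ge0 invf_le1// ler1n.
have e1 : e < 1 by rewrite gtrBl.
have th0 : 0 <= th by rewrite mulr_ge0// exprn_ge0// addr_ge0.
have the : th < (e * A) ^+ n.+1.
  by rewrite exprMn mulrC; move: pN; rewrite pE /th /e mulrC; lra.
have a0 : 0 < (e * A) ^+ n.+1 by exact: le_lt_trans the.
have q1 : `|th / (e * A) ^+ n.+1| < 1.
  by rewrite ger0_norm ?divr_ge0 ?(ltW a0)// ltr_pdivrMr// mul1r.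
have : N.+1%:R^-1 <= (0 : R).
  apply: (cvgr_to_ge (cvg_expr q1)).
  have [D _ DP] := cvgr_gt _ c1 _ e1.
  (* Starting at [D.+1] excludes the exponent 0, so the exponent has the form [m.+1] as in the
     hypothesis. *)
  exists D.+1 => // -[//|m] /= Dm.
  have Dd : (D <= m.+1 * n.+1)%N by nia.
  have /= ec := DP _ Dd.
  have {}ec : e ^+ (m.+1 * n.+1) <= c (m.+1 * n.+1)%N.
    have cpos : 0 < c (m.+1 * n.+1)%N by exact: c0.
    have -> : c (m.+1 * n.+1)%N =
        (c (m.+1 * n.+1)%N `^ (m.+1 * n.+1)%:R^-1) ^+ (m.+1 * n.+1).
      rewrite -powR_mulrn ?powR_ge0// -powRrM mulVf ?pnatr_eq0//.
      by rewrite powRr1 ?ltW.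
    by apply: lerXn2r; rewrite ?nnegrE ?powR_ge0//; exact: ltW.
  rewrite expr_div_n ler_pdivlMr ?(exprn_gt0 _ a0)// ler_pdivrMl//.
  apply: le_trans (cAB m N); rewrite [(e * A) ^+ _]exprMn exprMn.
  rewrite -[(e ^+ _) ^+ _]exprM (mulnC n.+1); apply: ler_wpM2r => //.
  by rewrite !exprn_ge0.
by rewrite leNgt invr_gt0 ltr0n.
Qed.

Lemma subexp_bound_Mahler :
  subexp_self_polar_bound R -> symmetric_Mahler_conjecture R.
Proof.
move=> [c csub cP] [//|n] K _ bK sK'; have sK := convex_body_sym bK sK'.
have vK0 : 0 <= fine (vol K) by apply: fine_ge0; exact: vol_ge0.
have vP0 : 0 <= fine (vol (polar K)) by apply: fine_ge0; exact: vol_ge0.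
rewrite (sym_body_vol sK) (sym_body_vol (sym_body_polar sK)) -EFinM lee_fin.
rewrite ler_pdivrMr ?ltr0n ?fact_gt0// -mulrA.
apply: (subexponential_le csub); rewrite ?mulr_ge0// => m N.
exact: self_polar_bound_cart_pow.
Qed.

(** By antisymmetry [omega x (- y) = omega y x], and this is at most 1 for [x], [y] in [X] because
    [x] lies in the symplectic polar. *)
Lemma self_polar_sym n (X : set 'rV[R]_(n + n)) : symplectic_polar X = X ->
  centrally_symmetric X.
Proof.
move=> XE; have omegaN x y : omega x (- y) = omega y x.
  by rewrite !omegaE !linearN !dotNr /= (dotC (rsubmx y)) (dotC (lsubmx y)); ring.
have XN y : X y -> X (- y).
  by move=> Xy; rewrite -XE => x Xx; rewrite omegaN; rewrite -XE in Xx; exact: Xx.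
rewrite /centrally_symmetric; apply/seteqP; split => [_ [x Xx <-]|x Xx].
  exact: XN.
by exists (- x); [exact: XN|rewrite opprK].
Qed.

(** [omega x y] is the dot product of [x] with the quarter turn of [y], so the symplectic polar is
    the preimage of the Euclidean polar under a volume-preserving map. *)
Lemma self_polar_vol_polar n (X : set 'rV[R]_(n + n)) :
  symplectic_polar X = X -> vol (polar X) = vol X.
Proof.
move=> XE; rewrite -(vol_rotate (borel_hpolar X 1)) -{2}XE; congr vol.
rewrite /symplectic_polar predeqE => y /=.
have omega_dot x : omega x y = dot x (row_mx (rsubmx y) (- lsubmx y)).
  by rewrite omegaE [in RHS]dotC dot_hsubmx dotNl (dotC (rsubmx y)) (dotC (lsubmx y)).
by split=> H x Xx; [rewrite omega_dot|rewrite -omega_dot]; exact: H.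
Qed.

Lemma Mahler_self_polar_bound : symmetric_Mahler_conjecture R ->
  forall n (X : set 'rV[R]_(n + n)), (0 < n)%N -> self_polar_body X ->
    ((2 ^+ n / n`!%:R)%:E <= vol X)%E.
Proof.
move=> mahler n X n0 [bX _ XE].
have sX := convex_body_sym bX (self_polar_sym XE).
have := mahler _ X (ltn_addr n n0) bX (self_polar_sym XE).
rewrite (self_polar_vol_polar XE) (sym_body_vol sX) -EFinM !lee_fin => H.
have v0 : 0 <= fine (vol X) by apply: fine_ge0; exact: vol_ge0.
rewrite -(@ler_pXn2r _ 2) ?nnegrE ?divr_ge0 ?exprn_ge0//.
apply: le_trans H; rewrite expr_div_n ler_pdivrMr ?exprn_gt0 ?ltr0n ?fact_gt0//.
rewrite mulrAC ler_pdivlMr ?ltr0n ?fact_gt0//.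
(* The central binomial coefficient is one term of [(1 + 1)^(2n)]; hence [(2n)! <= 4^n (n!)^2],
   which turns [16^n / (2n)!] into the square of [2^n / n!]. *)
have bin4 : ('C(n + n, n) <= 4 ^ n)%N.
  rewrite -[4%N]/(2 ^ 2)%N -expnM mul2n -addnn -[2%N]/(1 + 1)%N expnDn.
  have nn : (n < (n + n).+1)%N by rewrite ltnS leq_addr.
  by rewrite (bigD1 (Ordinal nn))//= !exp1n !muln1 leq_addr.
have := bin_fact (leq_addr n n); rewrite addnK => <-.
rewrite -exprM muln2 -addnn !natrM expr2 mulrCA mulrA.
rewrite ler_wpM2r ?mulr_ge0//.
have -> : 4 ^+ (n + n) = 2 ^+ (n + n) * (4 ^ n)%:R :> R.
  rewrite natrX -[4]/((2 * 2)%:R) natrM !exprMn !exprD; ring.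
by rewrite [leLHS]mulrC; apply: ler_wpM2l; rewrite ?exprn_ge0 ?ler_nat.
Qed.

End Mahler.

Theorem theorem1p2 (R : realType) :
  (subexp_self_polar_bound R <-> symmetric_Mahler_conjecture R) /\
  (subexp_self_polar_bound R ->
   forall (n : nat) (X : set 'rV[R]_(n + n)), (0 < n)%N -> self_polar_body X ->
     ((2 ^+ n / n`!%:R)%:E <= vol X)%E).
Proof.
have ab := @subexp_bound_Mahler R; have bc := @Mahler_self_polar_bound R.
split=> [|/ab]; last exact: bc.
split=> // /bc bound; exists (fun=> 1).
  split=> //; rewrite (_ : (fun n => _) = cst 1); first exact: cvg_cst.
  by apply/funext => n; rewrite powR1.
by move=> n X n0 sX; rewrite mul1r; exact: bound.
Qed.
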